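(* Let $\mathcal K(z;\mu)$ be a scheme transformation that lies in the commutant of $G=\langle C\rangle\times S_{N_f}$ at every Mellin moment and tends to the identity, $\mathcal K=1+O(a_s)$, but fails one or both of the momentum and number sum rules. Let $\eta_{\Sigma_-}(\mu)$ and $\eta_{\rm ns}^-(\mu)$ be the two scalars by which $\mathcal K(1;\mu)$ acts on the $C$-odd singlet $\Sigma_-$ and on the $C$-odd non-singlet sector, and let $$(n_\Sigma(\mu),n_g(\mu))=q_M^\dagger\,\mathcal K(2;\mu)^{-1}\big|_{\{\Sigma_+,g\}},\qquad q_M^\dagger|_{\{\Sigma_+,g\}}=(1,1).$$ Let $\mathcal K_{\mathcal N}(\mu)$ be a moment-independent ($z$-independent) element of the commutant of $G$ that carries the inverse of each $C$-odd scalar on its sector ($1/\eta_{\Sigma_-}$ on $\Sigma_-$ and $1/\eta^-_{\rm ns}$ on the $C$-odd non-singlet sector) and the diagonal matrix $\mathrm{diag}(n_\Sigma,n_g)$ on $(\Sigma_+,g)$. Then the product $\mathcal K_{\mathcal N}\mathcal K$ satisfies both covector conditions exactly, $$q_M^\dagger\,\mathcal K_{\mathcal N}(\mu)\mathcal K(2;\mu)=q_M^\dagger,\qquad q_{N,i}^\dagger\,\mathcal K_{\mathcal N}(\mu)\mathcal K(1;\mu)=q_{N,i}^\dagger\quad(i=1,\dots,N_f),$$ and is admissible. Thus a normalization by at most four numbers fixed by the sum rules (the two $C$-odd scalars at $z=1$ and the two diagonal entries $n_\Sigma,n_g$ at $z=2$) makes any transformation with the right symmetries and boundary behavior admissible,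 and this normalization acts in $x$ space as a pointwise reweighting, i.e. with kernel $\mathcal K_{\mathcal N}(\mu)\,\delta(1-x)$.
   Context: **Flavor space.** Dimension $2N_f+1$, basis labelled by $q_i,\bar q_i$ ($i=1,\dots,N_f$) and $g$. $C$ exchanges $q_i\leftrightarrow\bar q_i$ and fixes $g$. $S_{N_f}$ permutes flavors simultaneously on quarks and antiquarks. $\Sigma_\pm=\sum_i(q_i\pm\bar q_i)$. The $C$-even/$C$-odd non-singlet sectors are the traceless parts of $q_i\pm\bar q_i$ (absent for $N_f=1$). A matrix commuting with $G=\langle C\rangle\times S_{N_f}$ (an element of the commutant) is a $2\times2$ block on $\{\Sigma_+,g\}$ and a scalar on each of $\Sigma_-$ and the two non-singlet sectors. Covectors: $q_M^\dagger=(1,\dots,1)$ and $q_{N,i}^\dagger=e^\dagger_{q_i}-e^\dagger_{\bar q_i}$, where $e_j^\dagger$ selects the density of parton $j$. **Evolution and sum rules.** Mellin-space densities obey $\frac{d}{d\ln\mu^2}\overline f(z;\mu)=\gamma(z;\mu)\overline f(z;\mu)$, where $\gamma$ commutes with $G$ at every $z$ and $q_M^\dagger\gamma(2;\mu)=0$, $q_{N,i}^\dagger\gamma(1;\mu)=0$. The sum rules are $q_M^\dagger\overline f(2;\mu)=1$ and $q_{N,i}^\dagger\overline f(1;\mu)=n_{q_i}$ for all $\mu$, with fixed integers $n_{q_i}$. The coupling $a_s(\mu)$ satisfies $da_s/d\ln\mu^2=-\beta_0a_s^2-\cdots$, $\beta_0>0$, and $a_s\to0$ as $\mu\to\infty$.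 **Scheme transformation.** A matrix $\mathcal K(z;\mu)$, invertible and differentiable in $\mu$ at every moment, analytic in $z$ with $\mathcal K(\bar z;\mu)=\overline{\mathcal K(z;\mu)}$, acting by $\overline f^{(s)}=\mathcal K\overline f$ and $\gamma^{(s)}=\mathcal K\gamma\mathcal K^{-1}+\big(\tfrac{d\mathcal K}{d\ln\mu^2}\big)\mathcal K^{-1}$, and approaching the identity perturbatively, $\mathcal K=1+O(a_s)$ as $\mu\to\infty$, as a power series in $a_s$ with coefficients analytic in $z$. The matrix $\mathcal K_{\mathcal N}$ is itself understood to be a scheme transformation in this sense; its scalar on the $C$-even non-singlet sector is not constrained by the sum rules and is otherwise left unspecified. Statements are perturbative, so quantities of the form $1+O(a_s)$ are invertible. **Admissible.** A scheme transformation is admissible when $\gamma^{(s)}$ commutes with $G$ at every $z$ and the transformed densities obey the sum rules whenever the input densities do. *)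

(* Defs.v *)
(* Complex numbers are R[i], for R : realType. *)
From HB Require Import structures.
From mathcomp Require Import all_boot all_order all_algebra all_fingroup.
From mathcomp Require Import all_classical all_reals all_analysis.
From mathcomp Require Import complex.
Set Implicit Arguments.
Unset Strict Implicit.
Unset Printing Implicit Defensive.
Import Order.TTheory GRing.Theory Num.Theory numFieldNormedType.Exports.
Local Open Scope classical_set_scope.
Local Open Scope ring_scope.
Local Open Scope complex_scope.

(* The index type 'I_(Nf + Nf + 1) lists q_1..q_Nf, then qbar_1..qbar_Nf,
   then g. *)
Notation flavors Nf := (Nf + Nf + 1)%N (only parsing).

Section FlavorSpace.
Variables (R : realType) (Nf : nat).
Local Notation vec := 'cV[R[i]]_(flavors Nf).
Local Notation covec := 'rV[R[i]]_(flavors Nf).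
Local Notation mat := 'M[R[i]]_(flavors Nf).

Definition iq (i : 'I_Nf) : 'I_(flavors Nf) := lshift 1 (lshift Nf i).
Definition iqbar (i : 'I_Nf) : 'I_(flavors Nf) := lshift 1 (rshift Nf i).
Definition ig : 'I_(flavors Nf) := rshift (Nf + Nf) ord0.

Definition vec_e (j : 'I_(flavors Nf)) : vec := delta_mx j 0.
Definition covec_e (j : 'I_(flavors Nf)) : covec := delta_mx 0 j.

Definition C_mx : mat := block_mx (block_mx 0 1%:M 1%:M 0) 0 0 1%:M.
Definition S_mx (s : 'S_Nf) : mat :=
  block_mx (block_mx (perm_mx s) 0 0 (perm_mx s)) 0 0 1%:M.

(* Commutant of G = <C> x S_Nf; b is the exponent of C. *)
Definition in_commutant (A : mat) : Prop :=
  forall (b : bool) (s : 'S_Nf),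
    comm_mx ((if b then C_mx else 1%:M) *m S_mx s) A.

Definition vgluon : vec := vec_e ig.
Definition SigmaP : vec := \sum_i (vec_e (iq i) + vec_e (iqbar i)).
Definition SigmaM : vec := \sum_i (vec_e (iq i) - vec_e (iqbar i)).

(* The non-singlet sectors; both are {0} when Nf = 1. *)
Definition ns_even : set vec := [set v | exists c : 'I_Nf -> R[i],
  \sum_i c i = 0 /\ v = \sum_i c i *: (vec_e (iq i) + vec_e (iqbar i))].
Definition ns_odd : set vec := [set v | exists c : 'I_Nf -> R[i],
  \sum_i c i = 0 /\ v = \sum_i c i *: (vec_e (iq i) - vec_e (iqbar i))].

Definition acts_as (A : mat) (S : set vec) (c : R[i]) : Prop :=
  forall v, S v -> A *m v = c *: v.

Definition qM : covec := const_mx 1.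
Definition qN (i : 'I_Nf) : covec := covec_e (iq i) - covec_e (iqbar i).

(* Restriction of a covector to {Sigma_+, g}.  The first coordinate is the one
   for which the density Sigma_+ = sum_i (q_i + qbar_i) is the coordinate: the
   dual basis vector is SigmaP / (2 Nf), on which that density equals 1.  This
   is the normalization in which q_M restricts to (1, 1). *)
Definition restr_singlet (w : covec) : R[i] * R[i] :=
  ((w *m (((2 * Nf)%:R)^-1 *: SigmaP)) 0 0, (w *m vgluon) 0 0).

Lemma restr_singlet_qM : (0 < Nf)%N -> restr_singlet qM = (1, 1).
Proof.
move=> Nf_gt0; rewrite /restr_singlet.
have qMe j : (qM *m vec_e j) 0 0 = 1.
  rewrite mxE (bigD1 j) //= !mxE !eqxx mulr1 big1 ?addr0 // => k kj.
  by rewrite !mxE (negbTE kj) mulr0.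
rewrite qMe -scalemxAr mxE mulmx_sumr summxE.
rewrite (eq_bigr (fun=> 2%:R)); last first.
  by move=> i _; rewrite mulmxDr mxE !qMe.
rewrite sumr_const card_ord -mulrnA mulVf //.
by rewrite pnatr_eq0 -lt0n muln_gt0.
Qed.

End FlavorSpace.

Section Scale.
Variable R : realType.

(* d f / d ln mu^2 at mu: derivative in t = ln mu^2, i.e. mu = exp (t / 2). *)
Definition dlnmu2 (f : R -> R) (mu : R) : R :=
  derive1 (fun t : R => f (expR (t / 2))) (ln (mu ^+ 2)).

Definition cdlnmu2 (f : R -> R[i]) (mu : R) : R[i] :=
  dlnmu2 (fun m => complex.Re (f m)) mu +i* dlnmu2 (fun m => complex.Im (f m)) mu.

Definition mdlnmu2 (m n : nat) (f : R -> 'M[R[i]]_(m, n)) (mu : R) :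
    'M[R[i]]_(m, n) :=
  \matrix_(i, j) cdlnmu2 (fun nu => f nu i j) mu.

Definition cdifferentiable (f : R -> R[i]) (mu : R) : Prop :=
  derivable (fun m => complex.Re (f m)) mu 1 /\
  derivable (fun m => complex.Im (f m)) mu 1.

Definition mdifferentiable (m n : nat) (f : R -> 'M[R[i]]_(m, n)) (mu : R) :
    Prop :=
  forall i j, cdifferentiable (fun nu => f nu i j) mu.

(* Analyticity on an open set, as complex differentiability at each point. *)
Definition analytic_on (D : set R[i]) (f : R[i] -> R[i]) : Prop :=
  forall z, D z -> derivable (f : R[i]^o -> R[i]^o) z 1.

(* f ~ sum_k c_k a_s^k (asymptotic power series) as mu -> oo:
   f - sum_(k < N) c_k a_s^k = O(a_s^N) for every N. *)
Definition power_series_in (a_s : R -> R) (f : R -> R[i]) (c : nat -> R[i]) :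
    Prop :=
  forall N : nat,
    exists2 M : R, 0 < M & \forall mu \near +oo,
      `|f mu - \sum_(k < N) c k * (a_s mu ^+ k)%:C| <= (M * `|a_s mu ^+ N|)%:C.

(* The running coupling on scales mu > mu0:
   d a_s / d ln mu^2 = - beta_0 a_s^2 - beta_1 a_s^3 - ..., as an asymptotic
   series at a_s -> 0. *)
Definition coupling (mu0 : R) (a_s : R -> R) : Prop :=
  exists beta : nat -> R,
    [/\ 0 < beta 0%N,
        forall mu, mu0 < mu -> derivable a_s mu 1,
        forall N : nat,
          exists2 M : R, 0 < M & \forall mu \near +oo,
            `|dlnmu2 a_s mu + \sum_(k < N) beta k * a_s mu ^+ k.+2|
              <= M * `|a_s mu ^+ N.+2| &
        a_s @ +oo --> (0 : R)].

(* The set of Mellin moments at which all quantities are considered. *)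
Definition moment_domain (D : set R[i]) : Prop :=
  [/\ open (D : set R[i]^o), forall z, D z -> D z^*%C, D 1 & D 2%:R].

End Scale.

Section Schemes.
Variables (R : realType) (Nf : nat).
Variables (D : set R[i]) (mu0 : R).
Local Notation mat := 'M[R[i]]_(flavors Nf).
Local Notation vec := 'cV[R[i]]_(flavors Nf).

Definition transform_density (K : R[i] -> R -> mat) (f : R[i] -> R -> vec) :
    R[i] -> R -> vec :=
  fun z mu => K z mu *m f z mu.

Definition transform_gamma (K gamma : R[i] -> R -> mat) : R[i] -> R -> mat :=
  fun z mu => K z mu *m gamma z mu *m invmx (K z mu)
              + mdlnmu2 (K z) mu *m invmx (K z mu).

Definition anomalous_dimension (gamma : R[i] -> R -> mat) : Prop :=
  [/\ forall z mu, D z -> mu0 < mu -> in_commutant (gamma z mu),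
      forall mu, mu0 < mu -> qM R Nf *m gamma 2%:R mu = 0 &
      forall mu (i : 'I_Nf), mu0 < mu -> qN R i *m gamma 1 mu = 0].

Definition obeys_evolution (gamma : R[i] -> R -> mat) (f : R[i] -> R -> vec) :
    Prop :=
  forall z mu, D z -> mu0 < mu ->
    mdifferentiable (f z) mu /\ mdlnmu2 (f z) mu = gamma z mu *m f z mu.

Definition obeys_sum_rules (n : 'I_Nf -> int) (f : R[i] -> R -> vec) : Prop :=
  (forall mu, mu0 < mu -> (qM R Nf *m f 2%:R mu) 0 0 = 1) /\
  (forall mu (i : 'I_Nf), mu0 < mu -> (qN R i *m f 1 mu) 0 0 = (n i)%:~R).

Definition scheme_transformation (a_s : R -> R) (K : R[i] -> R -> mat) : Prop :=
  [/\ forall z mu, D z -> mu0 < mu ->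
        K z mu \in unitmx /\ mdifferentiable (K z) mu,
      forall mu i j, mu0 < mu -> analytic_on D (fun z => K z mu i j),
      forall z mu, D z -> mu0 < mu ->
        K z^*%C mu = map_mx (fun w => w^*%C) (K z mu) &
      exists Kc : nat -> R[i] -> mat,
        [/\ forall z, D z -> Kc 0%N z = 1%:M,
            forall k i j, analytic_on D (fun z => Kc k z i j) &
            forall z i j, D z ->
              power_series_in a_s (fun mu => K z mu i j)
                              (fun k => Kc k z i j)]].

Definition admissible (a_s : R -> R) (n : 'I_Nf -> int)
    (gamma K : R[i] -> R -> mat) : Prop :=
  [/\ scheme_transformation a_s K,
      forall z mu, D z -> mu0 < mu -> in_commutant (transform_gamma K gamma z mu) &
      forall f, obeys_evolution gamma f -> obeys_sum_rules n f ->
        obeys_sum_rules n (transform_density K f)].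

Definition sum_rule_covectors (K : R[i] -> R -> mat) : Prop :=
  (forall mu, mu0 < mu -> qM R Nf *m K 2%:R mu = qM R Nf) /\
  (forall mu (i : 'I_Nf), mu0 < mu -> qN R i *m K 1 mu = qN R i).

Definition odd_scalars (K : R[i] -> R -> mat) (etaS etaNS : R -> R[i]) : Prop :=
  forall mu, mu0 < mu ->
    K 1 mu *m SigmaM R Nf = etaS mu *: SigmaM R Nf /\
    acts_as (K 1 mu) (@ns_odd R Nf) (etaNS mu).

Definition nSigma (K : R[i] -> R -> mat) (mu : R) : R[i] :=
  (restr_singlet (qM R Nf *m invmx (K 2%:R mu))).1.
Definition ngluon (K : R[i] -> R -> mat) (mu : R) : R[i] :=
  (restr_singlet (qM R Nf *m invmx (K 2%:R mu))).2.

(* Moment independence is built into the type of KN. *)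
Definition normalization_of (K : R[i] -> R -> mat) (etaS etaNS : R -> R[i])
    (KN : R -> mat) : Prop :=
  forall mu, mu0 < mu ->
    [/\ in_commutant (KN mu),
        KN mu *m SigmaM R Nf = (etaS mu)^-1 *: SigmaM R Nf,
        acts_as (KN mu) (@ns_odd R Nf) (etaNS mu)^-1,
        KN mu *m SigmaP R Nf = nSigma K mu *: SigmaP R Nf &
        KN mu *m vgluon R Nf = ngluon K mu *: vgluon R Nf].

End Schemes.

Section XSpace.
Variables (R : realType) (n : nat).
Local Notation mat := 'M[R[i]]_n.
Local Notation vec := 'cV[R[i]]_n.

(* x^w for x > 0. *)
Definition cpow (x : R) (w : R[i]) : R[i] :=
  (expR (complex.Re w * ln x))%:C
  * (cos (complex.Im w * ln x) +i* sin (complex.Im w * ln x)).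

Definition cintegral (nu : {measure set (measurableTypeR R) -> \bar R})
    (A : set R) (f : R -> R[i]) : R[i] :=
  (\int[nu]_(x in A) complex.Re (f x)) +i* (\int[nu]_(x in A) complex.Im (f x)).

Definition mellin_integrable (f : R -> vec) (z : R[i]) : Prop :=
  forall i,
    (lebesgue_measure : {measure set (measurableTypeR R) -> \bar R}).-integrable
      `]0, 1] (fun x => (complex.Re (cpow x (z - 1) * f x i 0))%:E) /\
    (lebesgue_measure : {measure set (measurableTypeR R) -> \bar R}).-integrable
      `]0, 1] (fun x => (complex.Im (cpow x (z - 1) * f x i 0))%:E).

(* int_0^1 x^(z-1) f(x) dx *)
Definition mellin (f : R -> vec) (z : R[i]) : vec :=
  \col_i cintegral lebesgue_measure `]0, 1] (fun x => cpow x (z - 1) * f x i 0).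

(* A kernel is a matrix-valued distribution on (0, 1], given by its action on
   test functions; A delta(1-x) is A times the point mass at x = 1. *)
Definition delta_kernel (A : mat) : (R -> R[i]) -> mat :=
  fun phi => cintegral (dirac (1 : measurableTypeR R)) `]0, 1] phi *: A.

Definition mellin_kernel (k : (R -> R[i]) -> mat) (z : R[i]) : mat :=
  k (fun x => cpow x (z - 1)).

(* Mellin convolution: (k (x) f)(x) = int_x^1 dy / y k(y) f(x / y). *)
Definition convolution (k : (R -> R[i]) -> mat) (f : R -> vec) (x : R) : vec :=
  \col_i \sum_j
    (k (fun y => if x <= y <= 1 then f (x / y) j 0 / y%:C else 0)) i j.

Definition measurable_density (f : R -> vec) : Prop :=
  forall i,
    measurable_fun (`]0, 1] : set (measurableTypeR R))
      (fun x => complex.Re (f x i 0)) /\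
    measurable_fun (`]0, 1] : set (measurableTypeR R))
      (fun x => complex.Im (f x i 0)).

(* In x space, multiplication of Mellin moments by A is the convolution with
   A delta(1-x), which reweights pointwise in x. *)
Definition pointwise_reweighting (A : mat) : Prop :=
  [/\ forall z, mellin_kernel (delta_kernel A) z = A,
      forall f, measurable_density f -> forall x, 0 < x <= 1 ->
        convolution (delta_kernel A) f x = A *m f x &
      forall f z, mellin_integrable f z ->
        mellin (convolution (delta_kernel A) f) z = A *m mellin f z].

End XSpace.

(* Main.v *)
(* An element of the commutant is constant on orbits of pairs of flavors, so a
   G-invariant covector is fixed by its restriction to {Sigma_+, g}, and a C-odd
   one by its values on Sigma_- and the C-odd non-singlet sector.  On the first
   space q_M K_N(mu) and q_M K(2; mu)^-1 agree by the choice of (n_Sigma, n_g);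
   on the second K_N(mu) K(1; mu) is the identity.  Admissibility follows because
   the commutant is closed under products, inverses and d/d ln mu^2, and
   asymptotic power series in a_s under products.

   For the existence of K_N at large scales, the two C-odd scalars and, by
   Cramer's rule, n_Sigma and n_g are rational functions of the entries of
   K(1; mu) and K(2; mu); these are real since the moments 1 and 2 are, and all
   the denominators are 1 + O(a_s), hence invertible as asymptotic series. *)
Require Import Defs.
From HB Require Import structures.
From mathcomp Require Import all_boot all_order all_algebra all_fingroup.
From mathcomp Require Import all_classical all_reals all_analysis.
From mathcomp Require Import measurable_realfun.
From mathcomp Require Import complex ring.
Set Implicit Arguments.
Unset Strict Implicit.
Unset Printing Implicit Defensive.
Import Order.TTheory GRing.Theory Num.Theory numFieldNormedType.Exports.
Local Open Scope classical_set_scope.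
Local Open Scope ring_scope.
Local Open Scope complex_scope.

(** * Convolution with a point mass *)

(** The covector identities hold scale by scale and use only the symmetry and invertibility of K at
    each mu. Perturbation theory enters with the existence of K_N: the expansion controls K only as
    mu tends to infinity, so a denominator may vanish at a finite scale, and the existence statement
    has to move to mu > mu1. A K_N independent of z must also satisfy the reflection condition,
    hence be real, besides being differentiable and having an expansion with constant term 1. These
    requirements are bundled into one class of functions of mu that is closed under the field
    operations, so it suffices to write K_N explicitly in the entries of K. This is why the sector
    scalars are given by formulas in the entries for one chosen flavor, rather than as abstract
    eigenvalues. *)

Import HBNNSimple.
(* The supremum over the simple functions below an arbitrary f is attained at
   f(a) 1_{a}. *)
Lemma ge0_integralT_dirac_set1 d (T : measurableType d) (R : realType) (a : T)
    (f : T -> R) : measurable [set a] -> (forall x, 0 <= f x) ->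
  (\int[dirac a]_x (f x)%:E = (f a)%:E)%E.
Proof.
move=> ma f0; rewrite ge0_integralTE; last by move=> x; rewrite lee_fin.
apply/eqP; rewrite eq_le; apply/andP; split.
  apply: ge_ereal_sup => _ [h /= hf <-].
  rewrite -integralT_nnsfun integral_dirac//; last exact/measurable_EFinP.
  by rewrite diracT mul1e.
pose h := scale_nnsfun (indic_nnsfun R ma) (f0 a).
have hE x : h x = f a * \1_[set a] x by [].
apply: ereal_sup_ubound; exists h.
  move=> x; rewrite lee_fin [leLHS]hE indicE.
  by case: (boolP (x \in [set a])) => [/set_mem -> | _]; rewrite ?mulr1 ?mulr0.
rewrite -integralT_nnsfun integral_dirac//; last exact/measurable_EFinP.
by rewrite diracT mul1e hE indicE mem_set ?mulr1.
Qed.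

(** The function is arbitrary, not necessarily measurable: the nonnegative case applies to the
    positive and the negative part, and max(g a, 0) - max(- g a, 0) = g a. *)
Lemma Rintegral_dirac_set1 d (T : measurableType d) (R : realType) (a : T)
    (A : set T) (f : T -> R) : measurable [set a] -> A a ->
  \int[dirac a]_(x in A) f x = f a.
Proof.
move=> ma Aa; rewrite Rintegral_mkcond; set g := f \_ A.
have ga : g a = f a by rewrite /g patchT ?mem_set.
rewrite /Rintegral integralE -ga.
have -> : (\int[dirac a]_x ((EFin \o g)^\+ x) = (Num.max (g a) 0)%:E)%E.
  rewrite -(@ge0_integralT_dirac_set1 _ _ _ _ (fun x => Num.max (g x) 0)) //.
    by apply: eq_integral => x _; rewrite funeposE EFin_max.
  by move=> x; rewrite le_max lexx orbT.
have -> : (\int[dirac a]_x ((EFin \o g)^\- x) = (Num.max (- g a) 0)%:E)%E.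
  rewrite -(@ge0_integralT_dirac_set1 _ _ _ _ (fun x => Num.max (- g x) 0)) //.
    by apply: eq_integral => x _; rewrite funenegE EFin_max.
  by move=> x; rewrite le_max lexx orbT.
rewrite -EFinB /=; have [g0|g0] := leP (g a) 0.
  by rewrite max_l ?oppr_ge0// sub0r opprK.
by rewrite max_r ?subr0// oppr_le0 ltW.
Qed.

Section XSpace.
Variables (R : realType) (n : nat).

Lemma cintegral_dirac1 (phi : R -> R[i]) :
  cintegral (dirac (1 : measurableTypeR R)) `]0, 1] phi = phi 1.
Proof.
rewrite /cintegral !Rintegral_dirac_set1 //; try exact: measurable_set1;
  try by rewrite /= in_itv /= ltr01 lexx.
by case: (phi 1).
Qed.

Lemma cpow1 (w : R[i]) : cpow 1 w = 1.
Proof. by rewrite /cpow ln1 !mulr0 expR0 cos0 sin0 mul1r. Qed.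

(** The point mass sees only y = 1, which passes the cutoff because x <= 1, and there f (x / y) / y
    is f x. *)
Lemma convolution_delta (A : 'M[R[i]]_n) (f : R -> 'cV[R[i]]_n) (x : R) :
  x <= 1 -> convolution (delta_kernel A) f x = A *m f x.
Proof.
move=> x1; apply/matrixP => i j; rewrite ord1 !mxE; apply: eq_bigr => k _.
by rewrite /delta_kernel cintegral_dirac1 mxE x1 lexx divr1 divr1 mulrC.
Qed.

(** * Complex linearity of the integral over (0, 1] *)

Let leb : {measure set (measurableTypeR R) -> \bar R} := lebesgue_measure.

Definition cintegrable (f : R -> R[i]) :=
  leb.-integrable `]0, 1] (fun x => (complex.Re (f x))%:E) /\
  leb.-integrable `]0, 1] (fun x => (complex.Im (f x))%:E).

Let mI : measurable (`]0, 1] : set (measurableTypeR R)) := measurable_itv _.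

Lemma cintegrableZ (c : R[i]) f :
  cintegrable f -> cintegrable (fun x => c * f x).
Proof.
case: c => a b [f1 f2]; split.
  apply: (@eq_integrable _ _ _ leb _ mI (fun x =>
    a%:E * (complex.Re (f x))%:E - b%:E * (complex.Im (f x))%:E)%E).
    by move=> x _; case: (f x).
  by apply: integrableB => //; apply: integrableZl.
apply: (@eq_integrable _ _ _ leb _ mI (fun x =>
    a%:E * (complex.Im (f x))%:E + b%:E * (complex.Re (f x))%:E)%E).
  by move=> x _; case: (f x).
by apply: integrableD => //; apply: integrableZl.
Qed.

Lemma cintegrableD f g : cintegrable f -> cintegrable g ->
  cintegrable (fun x => f x + g x).
Proof.
move=> [f1 f2] [g1 g2]; split.
  apply: (@eq_integrable _ _ _ leb _ mI (fun x =>
    (complex.Re (f x))%:E + (complex.Re (g x))%:E)%E).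
    by move=> x _; case: (f x) (g x) => ? ? [].
  exact: integrableD.
apply: (@eq_integrable _ _ _ leb _ mI (fun x =>
    (complex.Im (f x))%:E + (complex.Im (g x))%:E)%E).
  by move=> x _; case: (f x) (g x) => ? ? [].
exact: integrableD.
Qed.

Lemma cintegralZ (c : R[i]) f :
  cintegrable f ->
  cintegral leb `]0, 1] (fun x => c * f x) = c * cintegral leb `]0, 1] f.
Proof.
case: c => a b [f1 f2]; rewrite /cintegral.
transitivity
  ((\int[leb]_(x in `]0, 1]) (a * complex.Re (f x) - b * complex.Im (f x))) +i*
   (\int[leb]_(x in `]0, 1]) (a * complex.Im (f x) + b * complex.Re (f x)))).
  by congr (_ +i* _); apply: eq_Rintegral => x _; case: (f x).
have intZ k g : leb.-integrable `]0, 1] (EFin \o g) ->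
    leb.-integrable `]0, 1] (EFin \o (fun x => k * g x)).
  by move=> /(integrableZl mI k).
by rewrite RintegralB ?RintegralD ?RintegralZl//; exact: intZ.
Qed.

Lemma cintegralD f g : cintegrable f -> cintegrable g ->
  cintegral leb `]0, 1] (fun x => f x + g x) =
  cintegral leb `]0, 1] f + cintegral leb `]0, 1] g.
Proof.
move=> [f1 f2] [g1 g2]; rewrite /cintegral.
transitivity
  ((\int[leb]_(x in `]0, 1]) (complex.Re (f x) + complex.Re (g x))) +i*
   (\int[leb]_(x in `]0, 1]) (complex.Im (f x) + complex.Im (g x)))).
  by congr (_ +i* _); apply: eq_Rintegral => x _; case: (f x) (g x) => ? ? [].
by rewrite !RintegralD.
Qed.

Lemma cintegral_sum I (r : seq I) (c : I -> R[i]) (f : I -> R -> R[i]) :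
  (forall i, cintegrable (f i)) ->
  cintegral leb `]0, 1] (fun x => \sum_(i <- r) c i * f i x) =
  \sum_(i <- r) c i * cintegral leb `]0, 1] (f i).
Proof.
(* Integrability of the partial sums is carried through the induction together with the formula,
   since additivity needs it. *)
move=> fi; suff [] : cintegrable (fun x => \sum_(i <- r) c i * f i x) /\
    cintegral leb `]0, 1] (fun x => \sum_(i <- r) c i * f i x) =
    \sum_(i <- r) c i * cintegral leb `]0, 1] (f i) by [].
elim: r => [|i r [IH1 IH2]].
  under eq_fun do rewrite big_nil.
  rewrite big_nil; split.
    by split; apply: integrable0.
  by rewrite /cintegral /= Rintegral_cst ?mul0r.
under eq_fun do rewrite big_cons.
rewrite big_cons; split; first by apply: cintegrableD => //; exact: cintegrableZ.
by rewrite cintegralD ?cintegralZ ?IH2//; exact: cintegrableZ.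
Qed.

Lemma pointwise_reweighting_mx (A : 'M[R[i]]_n) : pointwise_reweighting A.
Proof.
split.
- by move=> z; rewrite /mellin_kernel /delta_kernel cintegral_dirac1 cpow1 scale1r.
- by move=> f _ x /andP[_ x1]; exact: convolution_delta.
move=> f z fz; apply/matrixP => i j; rewrite ord1 !mxE.
under [RHS]eq_bigr do rewrite mxE.
rewrite -cintegral_sum; last by move=> k; exact: fz.
have eqc x : x \in (`]0, 1]%classic : set R) ->
    cpow x (z - 1) * convolution (delta_kernel A) f x i 0 =
    \sum_j A i j * (cpow x (z - 1) * f x j 0).
  rewrite inE /= in_itv /= => /andP[_ x1].
  rewrite convolution_delta // mxE mulr_sumr.
  by apply: eq_bigr => k _; rewrite mulrCA.
by rewrite /cintegral; congr (_ +i* _); apply: eq_Rintegral => x /eqc ->.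
Qed.

End XSpace.

(** * The commutant of the flavor symmetry *)

Section FlavorSymmetry.
Variables (R : realType) (Nf : nat).
Local Notation vec := 'cV[R[i]]_(flavors Nf).
Local Notation covec := 'rV[R[i]]_(flavors Nf).
Local Notation mat := 'M[R[i]]_(flavors Nf).
Local Notation ig := (ig Nf).

Variant flavor_spec : 'I_(flavors Nf) -> Type :=
| FlavorQuark i : flavor_spec (iq i)
| FlavorAntiquark i : flavor_spec (iqbar i)
| FlavorGluon : flavor_spec ig.

Lemma flavorP j : flavor_spec j.
Proof.
case: (split_ordP j) => k ->; last by rewrite ord1; constructor.
by case: (split_ordP k) => i ->; constructor.
Qed.

Lemma eq_iq (i j : 'I_Nf) : (iq i == iq j) = (i == j).
Proof. by rewrite /iq !eq_lshift. Qed.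
Lemma eq_iqbar (i j : 'I_Nf) : (iqbar i == iqbar j) = (i == j).
Proof. by rewrite /iqbar eq_lshift eq_rshift. Qed.
Lemma eq_iq_iqbar (i j : 'I_Nf) : (iq i == iqbar j) = false.
Proof. by rewrite /iq /iqbar eq_lshift eq_lrshift. Qed.
Lemma eq_iqbar_iq (i j : 'I_Nf) : (iqbar i == iq j) = false.
Proof. by rewrite eq_sym eq_iq_iqbar. Qed.
Lemma eq_iq_ig (i : 'I_Nf) : (iq i == ig) = false.
Proof. by rewrite /iq /Defs.ig eq_lrshift. Qed.
Lemma eq_iqbar_ig (i : 'I_Nf) : (iqbar i == ig) = false.
Proof. by rewrite /iqbar /Defs.ig eq_lrshift. Qed.
Lemma eq_ig_iq (i : 'I_Nf) : (ig == iq i) = false.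
Proof. by rewrite eq_sym eq_iq_ig. Qed.
Lemma eq_ig_iqbar (i : 'I_Nf) : (ig == iqbar i) = false.
Proof. by rewrite eq_sym eq_iqbar_ig. Qed.

Definition eq_flavor := (eq_iq, eq_iqbar, eq_iq_iqbar, eq_iqbar_iq, eq_iq_ig,
  eq_iqbar_ig, eq_ig_iq, eq_ig_iqbar, eqxx).

Lemma big_flavor (F : 'I_(flavors Nf) -> R[i]) :
  \sum_j F j = \sum_i (F (iq i) + F (iqbar i)) + F ig.
Proof. by rewrite !big_split_ord /= big_ord1 big_split. Qed.

Definition flavor_act (b : bool) (s : 'S_Nf) (j : 'I_(flavors Nf)) :=
  match fintype.split j with
  | inl k => match fintype.split k with
             | inl i => if b then iqbar (s i) else iq (s i)
             | inr i => if b then iq (s i) else iqbar (s i)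
             end
  | inr _ => ig
  end.

Lemma flavor_act_iq b s i :
  flavor_act b s (iq i) = if b then iqbar (s i) else iq (s i).
Proof. by rewrite /flavor_act /iq !(unsplitK (inl _)). Qed.
Lemma flavor_act_iqbar b s i :
  flavor_act b s (iqbar i) = if b then iq (s i) else iqbar (s i).
Proof. by rewrite /flavor_act /iqbar (unsplitK (inl _)) (unsplitK (inr _)). Qed.
Lemma flavor_act_ig b s : flavor_act b s ig = ig.
Proof. by rewrite /flavor_act /Defs.ig (unsplitK (inr _)). Qed.
Definition flavor_actE := (flavor_act_iq, flavor_act_iqbar, flavor_act_ig).

Lemma flavor_act_inj b s : injective (flavor_act b s).
Proof.
move=> i j; case: (flavorP i) => [k|k|]; case: (flavorP j) => [l|l|];
  rewrite !flavor_actE; case: b => /eqP; rewrite ?eq_flavor // => /eqP/perm_inj -> //.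
Qed.

Definition flavor_perm b s : {perm 'I_(flavors Nf)} := perm (@flavor_act_inj b s).

Lemma flavor_permE b s j : flavor_perm b s j = flavor_act b s j.
Proof. exact: permE. Qed.

Lemma G_mxE b s :
  (if b then C_mx R Nf else 1%:M) *m S_mx R s = perm_mx (flavor_perm b s).
Proof.
have -> : (if b then C_mx R Nf else 1%:M) *m S_mx R s =
    block_mx (if b then block_mx 0 (perm_mx s) (perm_mx s) 0
              else block_mx (perm_mx s) 0 0 (perm_mx s)) 0 0 1%:M.
  case: b; last by rewrite mul1mx.
  by rewrite /C_mx /S_mx !mulmx_block !(mul0mx, mulmx0, mul1mx, add0r, addr0).
apply/matrixP => i j; rewrite [RHS]mxE [RHS]mxE flavor_permE.
case: (flavorP i) => [k|k|]; case: (flavorP j) => [l|l|]; case: b;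
  rewrite !flavor_actE ?eq_flavor;
  rewrite /iq /iqbar /Defs.ig ?(block_mxEul, block_mxEur, block_mxEdl, block_mxEdr)
    !mxE ?eq_shift ?ord1 //.
Qed.

(** The elements of G are permutation matrices, and P A = A P for such a P says that A is unchanged
    when rows and columns are permuted together. This entrywise form is also what passes to the
    entrywise derivative. *)
Lemma in_commutantP (A : mat) : in_commutant A <->
  forall b s i j, A (flavor_act b s i) (flavor_act b s j) = A i j.
Proof.
have comm_permP p : comm_mx (perm_mx p) A <-> forall i j, A (p i) (p j) = A i j.
  rewrite /comm_mx -row_permE -[X in _ = A *m perm_mx X]invgK -col_permE.
  split=> [/matrixP eqA i j | eqA].
    by have := eqA i (p j); rewrite !mxE permK.
  by apply/matrixP => i j; rewrite !mxE -[in LHS](permKV p j) eqA.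
split=> [cA b s i j | cA b s].
  by rewrite -!flavor_permE; move: i j; apply/comm_permP; rewrite -G_mxE.
by rewrite G_mxE; apply/comm_permP => i j; rewrite !flavor_permE.
Qed.

Lemma in_commutant_mul (A B : mat) :
  in_commutant A -> in_commutant B -> in_commutant (A *m B).
Proof. by move=> cA cB b s; rewrite /comm_mx mulmxA cA -mulmxA cB mulmxA. Qed.

Lemma in_commutant_add (A B : mat) :
  in_commutant A -> in_commutant B -> in_commutant (A + B).
Proof. by move=> cA cB b s; rewrite /comm_mx mulmxDr mulmxDl cA cB. Qed.

Lemma in_commutant_scale c (A : mat) : in_commutant A -> in_commutant (c *: A).
Proof. by move=> cA b s; rewrite /comm_mx -scalemxAr -scalemxAl cA. Qed.

Lemma in_commutant1 : in_commutant (1%:M : mat).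
Proof. by move=> b s; rewrite /comm_mx mulmx1 mul1mx. Qed.

Lemma in_commutant_inv (A : mat) :
  A \in unitmx -> in_commutant A -> in_commutant (invmx A).
Proof.
move=> uA cA b s; rewrite /comm_mx; set P := _ *m S_mx R s.
have PA : P *m A = A *m P := cA b s.
by rewrite -[LHS](mulKmx uA) [A *m _]mulmxA -PA -!mulmxA mulmxV // mulmx1.
Qed.

Lemma vec_eE (j k : 'I_(flavors Nf)) l : vec_e R j k l = (k == j)%:R.
Proof. by rewrite mxE ord1 eqxx andbT. Qed.

Lemma mul_vec_e (A : mat) i j : (A *m vec_e R j) i 0 = A i j.
Proof. by rewrite /vec_e -colE mxE. Qed.

Lemma sumr_delta (i : 'I_Nf) (F : 'I_Nf -> R[i]) :
  \sum_j F j * (i == j)%:R = F i.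
Proof.
rewrite (bigD1 i) //= eqxx mulr1 big1 ?addr0 // => j ji.
by rewrite eq_sym (negbTE ji) mulr0.
Qed.

(** The coefficients need not sum to zero, so that c = 1 gives the entries of Sigma_+ and, in the
    odd version, those of Sigma_-. *)
Lemma ns_evenE (c : 'I_Nf -> R[i]) :
  let v := \sum_i c i *: (vec_e R (iq i) + vec_e R (iqbar i)) in
  [/\ forall i, v (iq i) 0 = c i, forall i, v (iqbar i) 0 = c i & v ig 0 = 0].
Proof.
split=> [i|i|]; rewrite summxE; under eq_bigr do rewrite !mxE !eq_flavor ?andbT.
- by under eq_bigr do rewrite addr0; rewrite sumr_delta.
- by under eq_bigr do rewrite add0r; rewrite sumr_delta.
- by rewrite big1 // => i _; rewrite addr0 mulr0.
Qed.

Lemma ns_oddE (c : 'I_Nf -> R[i]) :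
  let v := \sum_i c i *: (vec_e R (iq i) - vec_e R (iqbar i)) in
  [/\ forall i, v (iq i) 0 = c i, forall i, v (iqbar i) 0 = - c i & v ig 0 = 0].
Proof.
split=> [i|i|]; rewrite summxE; under eq_bigr do rewrite !mxE !eq_flavor ?andbT.
- by under eq_bigr do rewrite subr0; rewrite sumr_delta.
- by under eq_bigr do rewrite sub0r mulrN; rewrite sumrN sumr_delta.
- by rewrite big1 // => i _; rewrite subr0 mulr0.
Qed.

Lemma SigmaPE : [/\ forall i, SigmaP R Nf (iq i) 0 = 1,
  forall i, SigmaP R Nf (iqbar i) 0 = 1 & SigmaP R Nf ig 0 = 0].
Proof.
have -> : SigmaP R Nf =
    \sum_i (fun=> 1) i *: (vec_e R (iq i) + vec_e R (iqbar i)).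
  by apply: eq_bigr => i _; rewrite scale1r.
exact: ns_evenE.
Qed.

Lemma SigmaME : [/\ forall i, SigmaM R Nf (iq i) 0 = 1,
  forall i, SigmaM R Nf (iqbar i) 0 = -1 & SigmaM R Nf ig 0 = 0].
Proof.
have -> : SigmaM R Nf =
    \sum_i (fun=> 1) i *: (vec_e R (iq i) - vec_e R (iqbar i)).
  by apply: eq_bigr => i _; rewrite scale1r.
exact: ns_oddE.
Qed.

Lemma vgluonE : [/\ forall i, vgluon R Nf (iq i) 0 = 0,
  forall i, vgluon R Nf (iqbar i) 0 = 0 & vgluon R Nf ig 0 = 1].
Proof. by split=> [i|i|]; rewrite /vgluon vec_eE eq_flavor. Qed.

Hypothesis Nf_gt0 : (0 < Nf)%N.
Let i0 : 'I_Nf := Ordinal Nf_gt0.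

Lemma natNf_neq0 : Nf%:R != 0 :> R[i].
Proof. by rewrite pnatr_eq0 -lt0n. Qed.

(** A transposition, composed with C or not, carries q_i0 to any quark or antiquark. An invariant
    covector thus has one value on these 2 Nf entries, and the factor 1 / (2 Nf) turns their sum
    back into it. *)
Lemma restr_singletE (w : covec) :
  (forall b s j, w 0 (flavor_act b s j) = w 0 j) ->
  restr_singlet w = (w 0 (iq i0), w 0 ig).
Proof.
move=> wG; have wq i : w 0 (iq i) = w 0 (iq i0).
  by have := wG false (tperm i0 i) (iq i0); rewrite flavor_actE tpermL.
have wqb i : w 0 (iqbar i) = w 0 (iq i0).
  by have := wG true (tperm i0 i) (iq i0); rewrite flavor_actE tpermL.
have [P1 P2 P3] := SigmaPE; have [g1 g2 g3] := vgluonE.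
rewrite /restr_singlet -scalemxAr !mxE !big_flavor P3 g3; congr (_, _).
  under eq_bigr do rewrite P1 P2 !mulr1 wq wqb -mulr2n.
  rewrite sumr_const card_ord mulr0 addr0 -mulrnA -[X in _ * X]mulr_natl mulrA.
  by rewrite mulVf ?mul1r // pnatr_eq0 muln_eq0 -lt0n.
under eq_bigr do rewrite g1 g2 !mulr0 addr0.
by rewrite big1 // mulr1 add0r.
Qed.

Lemma restr_singlet_inj (w w' : covec) :
  (forall b s j, w 0 (flavor_act b s j) = w 0 j) ->
  (forall b s j, w' 0 (flavor_act b s j) = w' 0 j) ->
  restr_singlet w = restr_singlet w' -> w = w'.
Proof.
move=> wG wG'; rewrite !restr_singletE // => -[eq eg].
apply/rowP => j; case: (flavorP j) => [i|i|] //.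
  have := wG false (tperm i0 i) (iq i0); have := wG' false (tperm i0 i) (iq i0).
  by rewrite flavor_actE tpermL => -> ->.
have := wG true (tperm i0 i) (iq i0); have := wG' true (tperm i0 i) (iq i0).
by rewrite flavor_actE tpermL => -> ->.
Qed.

Lemma qM_invariant (A : mat) : in_commutant A ->
  forall b s j, (qM R Nf *m A) 0 (flavor_act b s j) = (qM R Nf *m A) 0 j.
Proof.
move=> /in_commutantP cA b s j; rewrite !mxE.
rewrite (reindex_inj (@flavor_act_inj b s)) /=.
by apply: eq_bigr => k _; rewrite cA !mxE.
Qed.

Lemma qM_normalized (KN K : mat) : in_commutant KN -> in_commutant K ->
  K \in unitmx ->
  KN *m SigmaP R Nf = (restr_singlet (qM R Nf *m invmx K)).1 *: SigmaP R Nf ->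
  KN *m vgluon R Nf = (restr_singlet (qM R Nf *m invmx K)).2 *: vgluon R Nf ->
  qM R Nf *m (KN *m K) = qM R Nf.
Proof.
move=> cN cK uK NP Ng.
suff qN : qM R Nf *m KN = qM R Nf *m invmx K by rewrite mulmxA qN mulmxKV.
apply: restr_singlet_inj; try exact: qM_invariant.
  exact/qM_invariant/in_commutant_inv.
rewrite [RHS]surjective_pairing.
move: (restr_singlet _).1 (restr_singlet _).2 NP Ng => x y NP Ng.
(* Since q_M restricts to (1, 1) and K_N is diagonal on Sigma_+ and g, the restriction of q_M K_N is
   exactly the pair of eigenvalues (x, y). *)
move: (restr_singlet_qM R Nf_gt0); rewrite /restr_singlet => -[qP qg].
rewrite -!mulmxA -scalemxAr NP Ng.
congr (_, _); last by rewrite -scalemxAr mxE qg mulr1.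
by rewrite scalerA mulrC -scalerA -scalemxAr mxE qP mulr1.
Qed.

(** Subtract the flavor average: the remaining coefficients delta_ij - 1 / Nf sum to zero. The
    family is left arbitrary to serve both q_i + qbar_i and q_i - qbar_i. *)
Lemma singlet_decomposition (e : 'I_Nf -> vec) (j : 'I_Nf) :
  exists2 c : 'I_Nf -> R[i], \sum_i c i = 0 &
    e j = Nf%:R^-1 *: (\sum_i e i) + \sum_i c i *: e i.
Proof.
exists (fun i => (j == i)%:R - Nf%:R^-1).
  rewrite sumrB sumr_const card_ord -[X in _ - X]mulr_natl mulfV ?natNf_neq0 //.
  have := sumr_delta j (fun=> 1); under eq_bigr do rewrite mul1r.
  by move=> ->; rewrite subrr.
rewrite scaler_sumr -big_split /= (bigD1 j) //= eqxx -scalerDl.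
rewrite (addrC Nf%:R^-1) subrK scale1r big1 ?addr0 // => i ij.
by rewrite -scalerDl eq_sym (negbTE ij) (addrC Nf%:R^-1) subrK scale0r.
Qed.

Lemma odd_decomposition (j : 'I_Nf) : exists2 v, @ns_odd R Nf v &
  vec_e R (iq j) - vec_e R (iqbar j) = Nf%:R^-1 *: SigmaM R Nf + v.
Proof.
have [c c0 e] :=
  singlet_decomposition (fun i => vec_e R (iq i) - vec_e R (iqbar i)) j.
by eexists; last exact: e; exists c.
Qed.

Lemma even_decomposition (j : 'I_Nf) : exists2 v, @ns_even R Nf v &
  vec_e R (iq j) + vec_e R (iqbar j) = Nf%:R^-1 *: SigmaP R Nf + v.
Proof.
have [c c0 e] :=
  singlet_decomposition (fun i => vec_e R (iq i) + vec_e R (iqbar i)) j.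
by eexists; last exact: e; exists c.
Qed.

(** Invariance under C makes the row of qbar_i the row of q_i with quarks and antiquarks exchanged,
    so q_N,i M is read off from M on the vectors q_k - qbar_k. These split into a multiple of
    Sigma_- and a traceless vector, and M fixes both. *)
Lemma qN_preserved (M : mat) (i : 'I_Nf) : in_commutant M ->
  M *m SigmaM R Nf = SigmaM R Nf -> acts_as M (@ns_odd R Nf) 1 ->
  qN R i *m M = qN R i.
Proof.
move=> /in_commutantP cM MS Mns; apply/rowP => j.
have qNE k : (qN R i *m M) 0 k = M (iq i) k - M (iqbar i) k.
  by rewrite /qN /covec_e mulmxBl -!rowE !mxE.
have Codd k : M (iq i) (iq k) - M (iq i) (iqbar k) = (i == k)%:R.
  have [v vo e] := odd_decomposition k.
  have : M *m (vec_e R (iq k) - vec_e R (iqbar k)) =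
         vec_e R (iq k) - vec_e R (iqbar k).
    by rewrite e mulmxDr -scalemxAr MS Mns // scale1r.
  move=> /(congr1 (fun u : vec => u (iq i) 0)).
  have subE (u w : vec) l : (u - w) l 0 = u l 0 - w l 0 by rewrite !mxE.
  by rewrite mulmxBr !subE !mul_vec_e !vec_eE !eq_flavor subr0.
have cM1 := cM true 1%g; rewrite qNE.
case: (flavorP j) => [k|k|].
- have := cM1 (iq i) (iqbar k); rewrite !flavor_actE !perm1 => ->.
  by rewrite Codd !mxE !eq_flavor /= subr0 eq_sym.
- have := cM1 (iq i) (iq k); rewrite !flavor_actE !perm1 => ->.
  by rewrite -opprB Codd !mxE !eq_flavor /= sub0r eq_sym.
- have := cM1 (iq i) ig; rewrite !flavor_actE !perm1 => ->.
  by rewrite subrr !mxE !eq_flavor /= subrr.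
Qed.

(** The value c = 0, whose inverse is 0 by convention, is harmless because invertibility of K then
    forces v = 0. It can occur for Nf = 1, where the C-odd non-singlet sector is {0} and its scalar
    is arbitrary. *)
Lemma mul_inverse_scalar (K KN : mat) (v : vec) c : K \in unitmx ->
  K *m v = c *: v -> KN *m v = c^-1 *: v -> KN *m K *m v = v.
Proof.
move=> uK Kv Nv; have [c0|c0] := eqVneq c 0.
  have -> : v = 0 by rewrite -(mulKmx uK v) Kv c0 scale0r mulmx0.
  by rewrite mulmx0.
by rewrite -mulmxA Kv -scalemxAr Nv scalerA mulfV // scale1r.
Qed.

(** * Sector scalars as functions of the matrix entries *)

Definition odd_entry (A : mat) (i j : 'I_Nf) : R[i] :=
  A (iq i) (iq j) - A (iq i) (iqbar j).

(** For A in the commutant all rows of [odd_entry A] have the same sum, which is the eigenvalue on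
    the all-ones vector, i.e. on Sigma_-. *)
Definition odd_singlet_scalar (A : mat) : R[i] := \sum_j odd_entry A i0 j.

(* [rev_ord i0] is the last flavor; for Nf = 1 it is i0 and the sum is empty. *)
Definition odd_ns_scalar (A : mat) : R[i] :=
  odd_entry A i0 i0 - \sum_(j | (j == rev_ord i0) && (j != i0)) odd_entry A i0 j.

Lemma commutant_odd (A : mat) (c : 'I_Nf -> R[i]) : in_commutant A ->
  A *m (\sum_i c i *: (vec_e R (iq i) - vec_e R (iqbar i))) =
  \sum_i (\sum_j odd_entry A i j * c j) *: (vec_e R (iq i) - vec_e R (iqbar i)).
Proof.
move=> /in_commutantP cA; set v := \sum_i c i *: _.
have [vq vqb vg] := ns_oddE c.
have [uq uqb ug] := ns_oddE (fun i => \sum_j odd_entry A i j * c j).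
have cA1 := cA true 1%g.
apply/matrixP => j k; rewrite ord1 {k} mxE big_flavor vg mulr0 addr0.
case: (flavorP j) => [i|i|].
- rewrite uq; apply: eq_bigr => k _; rewrite vq vqb /odd_entry.
  by rewrite mulrBl mulrN.
- rewrite uqb -sumrN; apply: eq_bigr => k _; rewrite vq vqb /odd_entry.
  have := cA1 (iqbar i) (iq k); have := cA1 (iqbar i) (iqbar k).
  rewrite !flavor_actE !perm1 => -> ->.
  by rewrite mulrBl mulrN opprB addrC.
- rewrite ug big1 // => k _; rewrite vq vqb.
  have := cA1 ig (iqbar k); rewrite !flavor_actE !perm1 => ->.
  by rewrite mulrN subrr.
Qed.

Lemma odd_entry_perm (A : mat) (s : 'S_Nf) i j : in_commutant A ->
  odd_entry A (s i) (s j) = odd_entry A i j.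
Proof.
move=> /in_commutantP cA; rewrite /odd_entry.
have := cA false s (iq i) (iq j); have := cA false s (iq i) (iqbar j).
by rewrite !flavor_actE => -> ->.
Qed.

Lemma odd_singlet_scalarP (A : mat) : in_commutant A ->
  A *m SigmaM R Nf = odd_singlet_scalar A *: SigmaM R Nf.
Proof.
move=> cA; have -> : SigmaM R Nf =
    \sum_i (fun=> 1) i *: (vec_e R (iq i) - vec_e R (iqbar i)).
  by apply: eq_bigr => i _; rewrite scale1r.
rewrite commutant_odd // scaler_sumr; apply: eq_bigr => i _.
rewrite scale1r; congr (_ *: _); rewrite /odd_singlet_scalar.
rewrite (reindex_inj (@perm_inj _ (tperm i0 i))) /=; apply: eq_bigr => j _.
by rewrite mulr1 -{1}(tpermL i0 i) odd_entry_perm.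
Qed.

(** S_Nf is transitive on flavors and on ordered pairs of distinct flavors, so [odd_entry A] has one
    value p on the diagonal and one value r off it; on coefficients of sum zero such a matrix acts
    as p - r. *)
Lemma odd_ns_scalarP (A : mat) : in_commutant A ->
  acts_as A (@ns_odd R Nf) (odd_ns_scalar A).
Proof.
move=> cA v [c [c0 ->]]; rewrite commutant_odd // scaler_sumr.
apply: eq_bigr => i _; rewrite scalerA; congr (_ *: _).
pose i1 := rev_ord i0.
have diag k : odd_entry A k k = odd_entry A i0 i0.
  by rewrite -(tpermL i0 k) odd_entry_perm.
have [i10|i10] := eqVneq i1 i0.
  have all0 (k : 'I_Nf) : k = i0.
    apply/val_inj/eqP; rewrite /= -leqn0.
    have := congr1 val i10; rewrite /= subn1 => Nf1.
    by have := ltn_ord k; rewrite -[X in (_ < X)%N](prednK Nf_gt0) Nf1.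
  have -> : odd_ns_scalar A = odd_entry A i0 i0.
    rewrite /odd_ns_scalar big1 ?subr0 // => j.
    by rewrite (all0 j) eqxx andbF.
  rewrite (bigD1 i) //= big1 ?addr0; last first.
    by move=> j; rewrite (all0 j) (all0 i) eqxx.
  by rewrite diag.
(* The permutation s takes (i0, i1) to (k, j): first send i0 to k, then exchange the image of i1
   with j, which leaves k fixed since both differ from k. *)
have off k j : k != j -> odd_entry A k j = odd_entry A i0 i1.
  move=> kj; pose s1 := tperm i0 k; pose s := (s1 * tperm (s1 i1) j)%g.
  have s1k : s1 i0 = k by rewrite tpermL.
  have <- : s i0 = k.
    rewrite permM s1k tpermD // eq_sym //.
    by rewrite -s1k (inj_eq perm_inj) eq_sym.
  have {1}<- : s i1 = j by rewrite permM tpermL.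
  exact: odd_entry_perm.
have -> : odd_ns_scalar A = odd_entry A i0 i0 - odd_entry A i0 i1.
  rewrite /odd_ns_scalar (eq_bigl (pred1 i1)) ?big_pred1_eq // => j /=.
  by rewrite -/i1; have [->|] := eqVneq j i1; rewrite ?i10.
rewrite (bigD1 i) //= diag [RHS]mulrBl.
congr (_ + _).
rewrite (eq_bigr (fun j => odd_entry A i0 i1 * c j)); last first.
  by move=> j ji; rewrite off // eq_sym.
rewrite -mulr_sumr -mulrN; congr (_ * _).
by move: c0; rewrite (bigD1 i) //= => /eqP; rewrite addrC addr_eq0 => /eqP.
Qed.

Definition quark_row (A : mat) j := \sum_i (A (iq i) j + A (iqbar i) j).

(** For A in the commutant, this is the determinant of its 2 x 2 block in the basis Sigma_+ / (2
    Nf), g, the one used by [restr_singlet]. *)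
Definition singlet_det (A : mat) : R[i] :=
  quark_row A (iq i0) * A ig ig - quark_row A ig * A ig (iq i0).

Lemma restr_singlet_inv (A : mat) : in_commutant A -> A \in unitmx ->
  singlet_det A != 0 ->
  restr_singlet (qM R Nf *m invmx A) =
  ((A ig ig - A ig (iq i0)) / singlet_det A,
   (quark_row A (iq i0) - quark_row A ig) / singlet_det A).
Proof.
move=> cA uA d0; have wG := qM_invariant (in_commutant_inv uA cA).
rewrite restr_singletE //; set w := _ *m _ in wG *.
have wq i : w 0 (iq i) = w 0 (iq i0).
  by have := wG false (tperm i0 i) (iq i0); rewrite flavor_actE tpermL.
have wqb i : w 0 (iqbar i) = w 0 (iq i0).
  by have := wG true (tperm i0 i) (iq i0); rewrite flavor_actE tpermL.
have eqw j : w 0 (iq i0) * quark_row A j + w 0 ig * A ig j = 1.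
  have : (w *m A) 0 j = 1 by rewrite mulmxKV // mxE.
  rewrite mxE big_flavor => <-; congr (_ + _); rewrite mulr_sumr.
  by apply: eq_bigr => i _; rewrite wq wqb mulrDr.
(* Cramer's rule for the singlet block of [w *m A = qM]. *)
have := eqw (iq i0); have := eqw ig.
set x := w 0 (iq i0); set y := w 0 ig => eg eq.
congr (_, _); apply: (mulIf d0); rewrite mulfVK // /singlet_det.
  rewrite -[in RHS](mulr1 (A ig ig)) -[in RHS](mulr1 (A ig (iq i0))) -{1}eq -eg.
  by ring.
rewrite -[in RHS](mulr1 (quark_row A (iq i0))) -[in RHS](mulr1 (quark_row A ig)).
by rewrite -{1}eg -eq; ring.
Qed.

(* Diagonal on the sectors: x on Sigma_+, y on g, s on Sigma_-, t on the C-odd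
   and 1 on the C-even non-singlet sector. *)
Definition sector_mx (x y s t : R[i]) : mat :=
  1%:M + ((x - 1) / (2 * Nf)%:R) *: (SigmaP R Nf *m (SigmaP R Nf)^T)
  + ((t - 1) / 2%:R) *: (1%:M + (-1) *: C_mx R Nf)
  + ((s - t) / (2 * Nf)%:R) *: (SigmaM R Nf *m (SigmaM R Nf)^T)
  + (y - 1) *: (vgluon R Nf *m (vgluon R Nf)^T).

(** The sign e accounts for Sigma_-, which C reverses; it appears squared in v v^T. *)
Lemma in_commutant_outer (v : vec) :
  (forall b s, exists2 e, e ^+ 2 = 1 &
     forall j, v (flavor_act b s j) 0 = e * v j 0) ->
  in_commutant (v *m v^T).
Proof.
move=> vG; apply/in_commutantP => b s i j; have [e e2 ve] := vG b s.
by rewrite !mxE !big_ord1 !mxE !ve mulrACA -expr2 e2 mul1r.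
Qed.

Lemma C_mxE : C_mx R Nf = perm_mx (flavor_perm true 1%g).
Proof. by rewrite -G_mxE /S_mx perm_mx1 -!scalar_mx_block mulmx1. Qed.

Lemma in_commutant_C : in_commutant (C_mx R Nf).
Proof.
move=> b s; rewrite /comm_mx G_mxE C_mxE -!perm_mxM.
congr perm_mx; apply/permP => j.
rewrite !permM !flavor_permE.
by case: (flavorP j) => *; rewrite !flavor_actE; case: b; rewrite ?flavor_actE ?perm1.
Qed.

Lemma in_commutant_sector_mx x y s t : in_commutant (sector_mx x y s t).
Proof.
have [P1 P2 P3] := SigmaPE; have [M1 M2 M3] := SigmaME.
have [g1 g2 g3] := vgluonE.
rewrite /sector_mx; repeat apply: in_commutant_add; try exact: in_commutant1;
  apply: in_commutant_scale.
- apply: in_commutant_outer => b p; exists 1; rewrite ?expr1n // => j.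
  rewrite mul1r.
  by case: (flavorP j) => *; rewrite !flavor_actE; case: b; rewrite ?(P1, P2).
- apply: in_commutant_add; first exact: in_commutant1.
  exact/in_commutant_scale/in_commutant_C.
- apply: in_commutant_outer => b p; exists (if b then -1 else 1).
    by case: b; rewrite ?sqrrN expr1n.
  move=> j; case: (flavorP j) => *; rewrite !flavor_actE; case: b;
    by rewrite ?(M1, M2, M3) ?mulr0 ?mulr1 ?mul1r ?mulN1r ?opprK.
- apply: in_commutant_outer => b p; exists 1; rewrite ?expr1n // => j.
  rewrite mul1r.
  by case: (flavorP j) => *; rewrite !flavor_actE; case: b; rewrite ?(g1, g2).
Qed.

Lemma mulC_mxE (v : vec) : [/\ forall i, (C_mx R Nf *m v) (iq i) 0 = v (iqbar i) 0,
  forall i, (C_mx R Nf *m v) (iqbar i) 0 = v (iq i) 0 &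
  (C_mx R Nf *m v) ig 0 = v ig 0].
Proof.
by rewrite C_mxE -row_permE; split=> [i|i|]; rewrite mxE flavor_permE flavor_actE ?perm1.
Qed.

Lemma dot_flavor (u v : vec) : u *m u^T *m v =
  (\sum_i (u (iq i) 0 * v (iq i) 0 + u (iqbar i) 0 * v (iqbar i) 0)
   + u ig 0 * v ig 0) *: u.
Proof.
rewrite -mulmxA (mx11_scalar (u^T *m v)) mul_mx_scalar; congr (_ *: _).
by rewrite mxE big_flavor !mxE; under eq_bigr do rewrite !mxE.
Qed.

(** On an eigenvector of C with eigenvalue d, the matrix 1 - C acts as 1 - d, which is 0 on C-even
    and 2 on C-odd vectors, whence the factor (t - 1) / 2. On Sigma_- this already produces t, and
    the term in s - t corrects it to s. *)
Lemma sector_mx_actE x y s t (v : vec) (a b d : R[i]) :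
  C_mx R Nf *m v = d *: v ->
  \sum_i (v (iq i) 0 + v (iqbar i) 0) = a ->
  \sum_i (v (iq i) 0 - v (iqbar i) 0) = b ->
  sector_mx x y s t *m v = v + ((x - 1) / (2 * Nf)%:R * a) *: SigmaP R Nf
    + ((t - 1) / 2%:R * (1 - d)) *: v
    + ((s - t) / (2 * Nf)%:R * b) *: SigmaM R Nf
    + ((y - 1) * v ig 0) *: vgluon R Nf.
Proof.
have [P1 P2 P3] := SigmaPE; have [M1 M2 M3] := SigmaME.
have [g1 g2 g3] := vgluonE.
move=> Cv <- <-.
have CE : (1%:M + (-1) *: C_mx R Nf) *m v = (1 - d) *: v.
  by rewrite mulmxDl mul1mx -scalemxAl Cv scalerA mulN1r scalerBl scale1r scaleNr.
have PE : SigmaP R Nf *m (SigmaP R Nf)^T *m v =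
    (\sum_i (v (iq i) 0 + v (iqbar i) 0)) *: SigmaP R Nf.
  rewrite dot_flavor P3 mul0r addr0; congr (_ *: _).
  by apply: eq_bigr => i _; rewrite P1 P2 !mul1r.
have ME : SigmaM R Nf *m (SigmaM R Nf)^T *m v =
    (\sum_i (v (iq i) 0 - v (iqbar i) 0)) *: SigmaM R Nf.
  rewrite dot_flavor M3 mul0r addr0; congr (_ *: _).
  by apply: eq_bigr => i _; rewrite M1 M2 mul1r mulN1r.
have gE : vgluon R Nf *m (vgluon R Nf)^T *m v = v ig 0 *: vgluon R Nf.
  rewrite dot_flavor g3 mul1r big1 ?add0r // => i _.
  by rewrite g1 g2 !mul0r addr0.
by rewrite /sector_mx !mulmxDl mul1mx -!scalemxAl CE PE ME gE !scalerA.
Qed.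

Lemma sector_mx_acts x y s t :
  [/\ sector_mx x y s t *m SigmaP R Nf = x *: SigmaP R Nf,
      sector_mx x y s t *m SigmaM R Nf = s *: SigmaM R Nf,
      acts_as (sector_mx x y s t) (@ns_even R Nf) 1,
      acts_as (sector_mx x y s t) (@ns_odd R Nf) t &
      sector_mx x y s t *m vgluon R Nf = y *: vgluon R Nf].
Proof.
have [P1 P2 P3] := SigmaPE; have [M1 M2 M3] := SigmaME.
have [g1 g2 g3] := vgluonE.
have N2 : (2 * Nf)%:R != 0 :> R[i] by rewrite pnatr_eq0 muln_eq0 -lt0n.
have Cvec (v : vec) d : (forall i, v (iqbar i) 0 = d * v (iq i) 0) -> d * d = 1 ->
    v ig 0 = d * v ig 0 -> C_mx R Nf *m v = d *: v.
  move=> vq d2 vg; have [C1 C2 C3] := mulC_mxE v.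
  apply/matrixP => j k; rewrite ord1 [RHS]mxE.
  case: (flavorP j) => [i|i|]; rewrite ?C1 ?C2 ?C3 ?vq //.
  by rewrite mulrA d2 mul1r.
have const2 : \sum_(i < Nf) (1 + 1) = (2 * Nf)%:R :> R[i].
  by rewrite sumr_const card_ord -mulr2n -mulrnA.
split.
- rewrite (@sector_mx_actE _ _ _ _ _ (2 * Nf)%:R 0 1).
  + rewrite subrr !mulr0 !scale0r !addr0 P3 mulr0 scale0r addr0 divfK //.
    by rewrite -{1}[SigmaP R Nf]scale1r -scalerDl addrC subrK.
  + by apply: Cvec => [i||]; rewrite ?P1 ?P2 ?P3 ?mulr1 ?mulr0.
  + by under eq_bigr do rewrite P1 P2.
  + by rewrite big1 // => i _; rewrite P1 P2 subrr.
- rewrite (@sector_mx_actE _ _ _ _ _ 0 (2 * Nf)%:R (-1)).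
  + rewrite M3 !mulr0 !scale0r !addr0 divfK // opprK -mulr2n.
    rewrite divfK ?pnatr_eq0 // -{1}[SigmaM R Nf]scale1r -!scalerDl.
    by congr (_ *: _); ring.
  + by apply: Cvec => [i||]; rewrite ?M1 ?M2 ?M3 ?mulr1 ?mulrN1 ?opprK ?mulr0.
  + by rewrite big1 // => i _; rewrite M1 M2 subrr.
  + by under eq_bigr do rewrite M1 M2 opprK.
- move=> v [c [c0 ->]]; set w := \sum_i _; have [w1 w2 w3] := ns_evenE c.
  rewrite (@sector_mx_actE _ _ _ _ _ 0 0 1).
  + by rewrite subrr w3 !mulr0 !scale0r !addr0 scale1r.
  + by apply: Cvec => [i||]; rewrite ?w1 ?w2 ?w3 ?mulr1 ?mul1r ?mulr0.
  + by under eq_bigr do rewrite w1 w2; rewrite big_split /= c0 addr0.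
  + by rewrite big1 // => i _; rewrite w1 w2 subrr.
- move=> v [c [c0 ->]]; set w := \sum_i _; have [w1 w2 w3] := ns_oddE c.
  rewrite (@sector_mx_actE _ _ _ _ _ 0 0 (-1)).
  + rewrite w3 !mulr0 !scale0r !addr0 opprK -mulr2n divfK ?pnatr_eq0 //.
    by rewrite -{1}[w]scale1r -scalerDl addrC subrK.
  + by apply: Cvec => [i||]; rewrite ?w1 ?w2 ?w3 ?mulN1r ?opprK ?mulr1 ?mulr0 ?oppr0.
  + by rewrite big1 // => i _; rewrite w1 w2 subrr.
  + by under eq_bigr do rewrite w1 w2 opprK; rewrite big_split /= c0 addr0.
- rewrite (@sector_mx_actE _ _ _ _ _ 0 0 1).
  + rewrite subrr g3 !mulr0 !scale0r !addr0 mulr1.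
    by rewrite -{1}[vgluon R Nf]scale1r -scalerDl addrC subrK.
  + by apply: Cvec => [i||]; rewrite ?g1 ?g2 ?g3 ?mulr1 ?mul1r.
  + by rewrite big1 // => i _; rewrite g1 g2 addr0.
  + by rewrite big1 // => i _; rewrite g1 g2 subr0.
Qed.

(** The sectors span: q_i and qbar_i are recovered from q_i + qbar_i and q_i - qbar_i, and each of
    these is a multiple of a singlet plus a traceless vector. *)
Lemma sector_ext (A B : mat) :
  A *m SigmaP R Nf = B *m SigmaP R Nf -> A *m SigmaM R Nf = B *m SigmaM R Nf ->
  (forall v, @ns_even R Nf v -> A *m v = B *m v) ->
  (forall v, @ns_odd R Nf v -> A *m v = B *m v) ->
  A *m vgluon R Nf = B *m vgluon R Nf -> A = B.
Proof.
move=> AP AM Ae Ao Ag.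
have two : 2%:R != 0 :> R[i] by rewrite pnatr_eq0.
have Aplus i : A *m (vec_e R (iq i) + vec_e R (iqbar i)) =
               B *m (vec_e R (iq i) + vec_e R (iqbar i)).
  by have [v ve ->] := even_decomposition i; rewrite !mulmxDr -!scalemxAr AP Ae.
have Aminus i : A *m (vec_e R (iq i) - vec_e R (iqbar i)) =
               B *m (vec_e R (iq i) - vec_e R (iqbar i)).
  by have [v ve ->] := odd_decomposition i; rewrite !mulmxDr -!scalemxAr AM Ao.
have Aq i : A *m vec_e R (iq i) = B *m vec_e R (iq i).
  have -> : vec_e R (iq i) = 2^-1 *: ((vec_e R (iq i) + vec_e R (iqbar i)) +
                                      (vec_e R (iq i) - vec_e R (iqbar i))).
    rewrite addrACA subrr addr0 -mulr2n -(scaler_nat _ (vec_e R (iq i))).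
    by rewrite scalerA mulVf // scale1r.
  by rewrite -!scalemxAr mulmxDr [in RHS]mulmxDr Aplus Aminus.
apply/matrixP => i j; rewrite -!mul_vec_e.
case: (flavorP j) => [k|k|]; rewrite ?Aq //; last by rewrite Ag.
have -> : vec_e R (iqbar k) = (vec_e R (iq k) + vec_e R (iqbar k)) - vec_e R (iq k).
  by rewrite addrC addKr.
by rewrite mulmxBr [in RHS]mulmxBr Aplus Aq.
Qed.

Lemma sector_mx_unit x y s t : x != 0 -> y != 0 -> s != 0 -> t != 0 ->
  sector_mx x y s t \in unitmx.
Proof.
move=> x0 y0 s0 t0.
suff : sector_mx x y s t *m sector_mx x^-1 y^-1 s^-1 t^-1 = 1%:M.
  by case/mulmx1_unit.
have [N1 N2 N3 N4 N5] := sector_mx_acts x y s t.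
have [V1 V2 V3 V4 V5] := sector_mx_acts x^-1 y^-1 s^-1 t^-1.
apply: sector_ext; rewrite ?mul1mx.
- by rewrite -mulmxA V1 -scalemxAr N1 scalerA mulVf // scale1r.
- by rewrite -mulmxA V2 -scalemxAr N2 scalerA mulVf // scale1r.
- by move=> v ve; rewrite mul1mx -mulmxA V3 // scale1r N3 // scale1r.
- by move=> v ve; rewrite mul1mx -mulmxA V4 // -scalemxAr N4 // scalerA mulVf // scale1r.
- by rewrite -mulmxA V5 -scalemxAr N5 scalerA mulVf // scale1r.
Qed.
End FlavorSymmetry.

(** * Asymptotic power series in the coupling *)

Section AsymptoticSeries.
Variables (R : realType) (a : R -> R).
Hypothesis a_cvg0 : a @ +oo --> (0 : R).

Definition bigO_pow (N : nat) (e : R -> R[i]) : Prop :=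
  exists2 M : R, 0 < M & \forall mu \near +oo,
    `|e mu| <= (M * `|a mu ^+ N|)%:C.

Lemma normcR (x : R) : `|x%:C| = `|x|%:C.
Proof. by rewrite normc_def /= expr0n /= addr0 sqrtr_sqr. Qed.

Lemma near_a_le1 : \forall mu \near +oo, `|a mu| <= 1.
Proof.
move/cvgrPdist_le: a_cvg0 => /(_ 1 ltr01).
by apply: filterS => mu; rewrite sub0r normrN.
Qed.

Lemma bigO_pow_eq N e e' : e =1 e' -> bigO_pow N e -> bigO_pow N e'.
Proof. by move=> /funext ->. Qed.

Lemma bigO_powD N e e' : bigO_pow N e -> bigO_pow N e' ->
  bigO_pow N (fun mu => e mu + e' mu).
Proof.
move=> [M M0 eM] [M' M'0 eM']; exists (M + M'); first exact: addr_gt0.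
apply: filterS2 eM eM' => mu h h'; apply: le_trans (ler_normD _ _) _.
by rewrite mulrDl rmorphD lerD.
Qed.

Lemma bigO_powM m n e e' : bigO_pow m e -> bigO_pow n e' ->
  bigO_pow (m + n) (fun mu => e mu * e' mu).
Proof.
move=> [M M0 eM] [M' M'0 eM']; exists (M * M'); first exact: mulr_gt0.
apply: filterS2 eM eM' => mu h h'.
by rewrite normrM exprD normrM mulrACA rmorphM ler_pM.
Qed.

Lemma bigO_powW m n e : (n <= m)%N -> bigO_pow m e -> bigO_pow n e.
Proof.
move=> nm [M M0 eM]; exists M => //; apply: filterS2 near_a_le1 eM => mu a1 h.
apply: le_trans h _; rewrite lecR; apply: ler_wpM2l; first exact: ltW.
by rewrite !normrX ler_wiXn2l.
Qed.

Lemma bigO_pow_cst c : bigO_pow 0 (fun=> c).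
Proof.
(* The norm on [R[i]] is itself [R[i]]-valued, hence the real part; adding 1 keeps the constant
   positive at c = 0. *)
exists (complex.Re `|c| + 1).
  by rewrite ltr_wpDl // normc_def /= sqrtr_ge0.
apply: nearW => mu; rewrite expr0 normr1 mulr1 normc_def /= lecR.
by rewrite lerDl ler01.
Qed.

Lemma bigO_pow_coupling N : bigO_pow N (fun mu => (a mu ^+ N)%:C).
Proof. by exists 1 => //; apply: nearW => mu; rewrite mul1r normcR. Qed.

Lemma bigO_pow_horner (p : {poly R[i]}) : bigO_pow 0 (fun mu => p.[(a mu)%:C]).
Proof.
elim/poly_ind: p => [|p c IH].
  by under eq_fun do rewrite horner0; exact: bigO_pow_cst.
under eq_fun do rewrite hornerMXaddC.
apply: bigO_powD; last exact: bigO_pow_cst.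
rewrite -[0%N]/(0 + 0)%N; apply: bigO_powM => //.
by apply: (@bigO_powW 1) => //; under eq_fun do rewrite -[a _]expr1;
  exact: bigO_pow_coupling.
Qed.

Lemma bigO_pow_hornerXn (p : {poly R[i]}) N :
  bigO_pow N (fun mu => (p * 'X^N).[(a mu)%:C]).
Proof.
under eq_fun do rewrite hornerM hornerXn -rmorphXn.
rewrite -[N in bigO_pow N]add0n.
by apply: bigO_powM; [exact: bigO_pow_horner|exact: bigO_pow_coupling].
Qed.

(** As polynomials in the coupling, products of partial sums are truncated by [take_poly], and the
    discarded part is visibly a multiple of 'X^N. *)
Definition trunc_series N (c : nat -> R[i]) : {poly R[i]} := \poly_(k < N) c k.

Lemma power_series_inE f c : power_series_in a f c <->
  forall N, bigO_pow N (fun mu => f mu - (trunc_series N c).[(a mu)%:C]).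
Proof.
have eqh N mu : \sum_(k < N) c k * (a mu ^+ k)%:C = (trunc_series N c).[(a mu)%:C].
  by rewrite horner_poly; apply: eq_bigr => k _; rewrite rmorphXn.
by split=> h N; have [M M0 hM] := h N; exists M => //;
  apply: filterS hM => mu; rewrite eqh.
Qed.

Lemma power_series_bounded f c : power_series_in a f c -> bigO_pow 0 f.
Proof.
move=> /(_ 0%N); apply: bigO_pow_eq => mu.
by rewrite big_ord0 subr0.
Qed.

Lemma power_series_cst c : power_series_in a (fun=> c) (fun k => if k is 0%N then c else 0).
Proof.
apply/power_series_inE => -[|N].
  by under eq_fun do rewrite /trunc_series poly_def big_ord0 horner0 subr0;
    exact: bigO_pow_cst.
exists 1 => //; apply: nearW => mu; rewrite horner_poly big_ord_recl /= big1.
  by rewrite expr0 mulr1 addr0 subrr normr0 mul1r lecR.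
by move=> i _; rewrite mul0r.
Qed.

Lemma power_seriesD f g c d : power_series_in a f c -> power_series_in a g d ->
  power_series_in a (fun mu => f mu + g mu) (fun k => c k + d k).
Proof.
move=> fc gd N; apply: bigO_pow_eq (bigO_powD (fc N) (gd N)) => mu.
rewrite addrACA -opprD -big_split /=; congr (_ - _).
by apply: eq_bigr => k _; rewrite mulrDl.
Qed.

Lemma take_trunc_seriesM N c d :
  take_poly N (trunc_series N c * trunc_series N d) =
  trunc_series N (fun k => \sum_(i < k.+1) c i * d (k - i)%N).
Proof.
apply/polyP => k; rewrite coef_take_poly coef_poly; case: ltnP => // kN.
rewrite coefM; apply: eq_bigr => i _; rewrite !coef_poly.
by rewrite (leq_ltn_trans _ kN) ?leq_ord // (leq_ltn_trans _ kN) ?leq_subr.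
Qed.

(** With T the truncation of p q below order N, f g - T = (f - p) g + p (g - q) + (p q - T). Each
    term is O(a^N), because g and p are bounded near infinity and p q - T is a multiple of 'X^N. *)
Lemma power_seriesM f g c d : power_series_in a f c -> power_series_in a g d ->
  power_series_in a (fun mu => f mu * g mu)
    (fun k => \sum_(i < k.+1) c i * d (k - i)%N).
Proof.
move=> fc gd; apply/power_series_inE => N; rewrite -take_trunc_seriesM.
set p := trunc_series N c; set q := trunc_series N d.
have fO := (power_series_inE f c).1 fc N; have gO := (power_series_inE g d).1 gd N.
have gb := power_series_bounded gd.
have h1 : bigO_pow N (fun mu => (f mu - p.[(a mu)%:C]) * g mu).
  by rewrite -[N in bigO_pow N]addn0; exact: bigO_powM.
have h2 : bigO_pow N (fun mu => p.[(a mu)%:C] * (g mu - q.[(a mu)%:C])).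
  by apply: (bigO_powM (m := 0)) => //; exact: bigO_pow_horner.
have h3 := bigO_pow_hornerXn (drop_poly N (p * q)) N.
apply: bigO_pow_eq (bigO_powD (bigO_powD h1 h2) h3) => mu.
have -> : (drop_poly N (p * q) * 'X^N) = p * q - take_poly N (p * q).
  by rewrite -[X in X - _](poly_take_drop N) addrC addKr.
by rewrite hornerD hornerN hornerM; ring.
Qed.

Lemma inverse_series_exists (c : nat -> R[i]) : c 0%N != 0 ->
  exists d : nat -> R[i],
    forall k, \sum_(i < k.+1) c i * d (k - i)%N = (k == 0%N)%:R.
Proof.
move=> c0.
(* The recursion d_k = ([k = 0] - sum over i < k of c_(i+1) d_(k-i-1)) / c_0 refers to all earlier
   coefficients, so the list of them is what is iterated. *)
pose step (s : seq R[i]) :=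
  rcons s (((size s == 0%N)%:R -
            \sum_(i < size s) c i.+1 * s`_(size s - i.+1)) / c 0%N).
pose l n := iter n step [::].
have sl n : size (l n) = n by elim: n => //= n IH; rewrite size_rcons IH.
have lE n k : (k < n)%N -> (l n)`_k = (l k.+1)`_k.
  elim: n => // n IH; rewrite ltnS leq_eqVlt => /predU1P[->//|kn].
  by rewrite /= nth_rcons sl kn IH.
exists (fun k => (l k.+1)`_k) => k; rewrite big_ord_recl subn0.
rewrite {1}/l iterS -/(l k) nth_rcons sl ltnn eqxx mulrC divfK //.
rewrite [X in _ + X](eq_bigr (fun i : 'I_k => c i.+1 * (l k)`_(k - i.+1))) ?subrK // => i _.
by rewrite [in RHS]lE // ltn_subrL (leq_trans _ (ltn_ord i)).
Qed.

(** Eventually f - c_0 = O(a) is at most half of |c_0|. The bound away from zero is uniform, as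
    needed for 1 / f to be bounded. *)
Lemma power_series_neq0 f c : power_series_in a f c -> c 0%N != 0 ->
  exists2 m : R, 0 < m & \forall mu \near +oo, m%:C <= `|f mu|.
Proof.
move=> /(_ 1%N)[M M0 fM] c0.
have nc : `|c 0%N| = (complex.Re `|c 0%N|)%:C by rewrite normc_def.
have c0' : 0 < complex.Re `|c 0%N|.
  by rewrite -ltcR -nc normr_gt0.
set r := complex.Re _ in nc c0'; exists (r / 2); first by rewrite divr_gt0.
have /cvgrPdist_le/(_ (r / 2 / M)) := a_cvg0.
have rM : 0 < r / 2 / M by rewrite !divr_gt0.
move=> /(_ rM) aM; apply: filterS2 fM aM => mu.
rewrite big_ord1 expr0 mulr1 expr1 sub0r normrN => h1 h2.
have : `|f mu - c 0%N| <= (r / 2)%:C.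
  by apply: le_trans h1 _; rewrite lecR mulrC -ler_pdivlMr.
move=> h3; have := lerB_dist (c 0%N) (f mu); rewrite distrC => /le_trans/(_ h3).
rewrite nc lerBlDr -lerBlDl -rmorphB /=.
by have -> : r - r / 2 = r / 2 by field.
Qed.

Lemma power_seriesV f c : power_series_in a f c -> c 0%N != 0 ->
  exists2 d, d 0%N = (c 0%N)^-1 & power_series_in a (fun mu => (f mu)^-1) d.
Proof.
move=> fc c0; have [d cd] := inverse_series_exists c0; exists d.
  have := cd 0%N; rewrite big_ord1 subn0 eqxx => h.
  by apply: (mulfI c0); rewrite h mulfV.
have [m m0 fm] := power_series_neq0 fc c0.
have fV : bigO_pow 0 (fun mu => (f mu)^-1).
  exists m^-1; rewrite ?invr_gt0 //; apply: filterS fm => mu h.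
  rewrite expr0 normr1 mulr1 normfV rmorphV ?unitfE ?gt_eqF //.
  have m0' : 0 < m%:C by rewrite ltcR.
  by rewrite lef_pV2 // posrE // (lt_le_trans m0').
apply/power_series_inE => N; set q := trunc_series N d.
set p := trunc_series N c.
have fO := (power_series_inE f c).1 fc N.
(* 1/f - q = -(f q - 1)/f, and f q - 1 = (f - p) q + (p q - 1) is O(a^N). *)
have pq : p * q - 1 = (drop_poly N (p * q) - drop_poly N 1) * 'X^N.
  rewrite mulrBl -[X in X - 1 = _](poly_take_drop N).
  rewrite -[X in _ - X = _](poly_take_drop N) opprD addrACA.
  suff -> : take_poly N (p * q) = take_poly N 1 by rewrite subrr add0r.
  rewrite take_trunc_seriesM; apply/polyP => k.
  by rewrite coef_poly coef_take_poly cd coef1.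
have h1 : bigO_pow N (fun mu => (f mu - p.[(a mu)%:C]) * q.[(a mu)%:C]).
  by rewrite -[N in bigO_pow N]addn0; apply: bigO_powM => //; exact: bigO_pow_horner.
have h2 := bigO_pow_hornerXn (drop_poly N (p * q) - drop_poly N 1) N.
have [M M0 h] := bigO_powM (bigO_powM (bigO_pow_cst (-1)) fV) (bigO_powD h1 h2).
exists M => //; apply: filterS2 fm h => mu fm0 /=; rewrite -pq.
have f0 : f mu != 0.
  rewrite -normr_gt0; apply: lt_le_trans fm0; by rewrite ltcR.
set x := (X in `|X| <= _); set y := (X in _ -> `|X| <= _).
suff -> : x = y by [].
by rewrite /x /y hornerD hornerN hornerC hornerM; field.
Qed.
End AsymptoticSeries.

(** * Derivatives *)

Section ScaleDerivatives.
Variable R : realType.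
Implicit Types (f g : R -> R[i]) (mu : R) (D : set R[i]).

Lemma cdifferentiable_cst c mu : cdifferentiable (fun=> c) mu.
Proof. by split; exact: derivable_cst. Qed.

Lemma cdifferentiableD f g mu : cdifferentiable f mu -> cdifferentiable g mu ->
  cdifferentiable (fun m => f m + g m) mu.
Proof.
move=> [f1 f2] [g1 g2]; split; under eq_fun do rewrite raddfD.
  exact: (derivableD f1 g1).
exact: (derivableD f2 g2).
Qed.

Lemma cdifferentiableM f g mu : cdifferentiable f mu -> cdifferentiable g mu ->
  cdifferentiable (fun m => f m * g m) mu.
Proof.
move=> [f1 f2] [g1 g2].
have ReM x y : complex.Re (x * y) =
    complex.Re x * complex.Re y - complex.Im x * complex.Im y :> R.
  by case: x y => ? ? [].
have ImM x y : complex.Im (x * y) =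
    complex.Re x * complex.Im y + complex.Im x * complex.Re y :> R.
  by case: x y => ? ? [].
split; [under eq_fun do rewrite ReM | under eq_fun do rewrite ImM].
  exact: (derivableB (derivableM f1 g1) (derivableM f2 g2)).
exact: (derivableD (derivableM f1 g2) (derivableM f2 g1)).
Qed.

Lemma cdifferentiable_sum I (r : seq I) (F : I -> R -> R[i]) mu :
  (forall i, cdifferentiable (F i) mu) ->
  cdifferentiable (fun m => \sum_(i <- r) F i m) mu.
Proof.
move=> dF; elim: r => [|i r IH].
  by under eq_fun do rewrite big_nil; exact: cdifferentiable_cst.
under eq_fun do rewrite big_cons.
exact: (cdifferentiableD (dF i) IH).
Qed.

Lemma cdifferentiableV f mu : f mu != 0 -> cdifferentiable f mu ->
  cdifferentiable (fun m => (f m)^-1) mu.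
Proof.
move=> f0 [f1 f2].
(* Differentiability is that of the real and imaginary parts, so the inverse is written as the
   conjugate of f over n = |f|^2. *)
pose n m := complex.Re (f m) ^+ 2 + complex.Im (f m) ^+ 2.
have n0 : n mu != 0.
  apply: contra f0; rewrite /n paddr_eq0 ?sqr_ge0 // !sqrf_eq0.
  by case: (f mu) => x y /= /andP[/eqP -> /eqP ->].
have dn : derivable n mu 1.
  exact: (derivableD (derivableM f1 f1) (derivableM f2 f2)).
have dnV := derivableV n0 dn.
have ReV m : complex.Re (f m)^-1 = complex.Re (f m) * (n m)^-1.
  by rewrite /n; case: (f m).
have ImV m : complex.Im (f m)^-1 = - complex.Im (f m) * (n m)^-1.
  by rewrite /n mulNr; case: (f m).
split; [under eq_fun do rewrite ReV | under eq_fun do rewrite ImV].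
  exact: (derivableM f1 dnV).
exact: (derivableM (derivableN f2) dnV).
Qed.

Lemma mdifferentiable_mul m n p (A : R -> 'M[R[i]]_(m, n))
    (B : R -> 'M[R[i]]_(n, p)) mu :
  mdifferentiable A mu -> mdifferentiable B mu ->
  mdifferentiable (fun nu => A nu *m B nu) mu.
Proof.
move=> dA dB i j; under eq_fun do rewrite mxE.
apply: (@cdifferentiable_sum _ _ (fun k nu => A nu i k * B nu k j)) => k.
exact: (cdifferentiableM (dA i k) (dB k j)).
Qed.

Lemma analytic_on_cst D c : analytic_on D (fun=> c).
Proof. by move=> z _; exact: derivable_cst. Qed.

Lemma analytic_on_add D (f g : R[i] -> R[i]) :
  analytic_on D f -> analytic_on D g -> analytic_on D (fun z => f z + g z).
Proof. by move=> df dg z Dz; exact: (derivableD (df z Dz) (dg z Dz)). Qed.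

Lemma analytic_on_mul D (f g : R[i] -> R[i]) :
  analytic_on D f -> analytic_on D g -> analytic_on D (fun z => f z * g z).
Proof.
move=> df dg z Dz.
exact: (@derivableM R[i] R[i]^o f g z 1 (df z Dz) (dg z Dz)).
Qed.

Lemma analytic_on_sum D I (r : seq I) (F : I -> R[i] -> R[i]) :
  (forall i, analytic_on D (F i)) -> analytic_on D (fun z => \sum_(i <- r) F i z).
Proof.
move=> dF; elim: r => [|i r IH].
  by under eq_fun do rewrite big_nil; exact: analytic_on_cst.
under eq_fun do rewrite big_cons.
exact: (analytic_on_add (dF i) IH).
Qed.

Lemma analytic_on_mulmx D m n p (A : R[i] -> 'M[R[i]]_(m, n))
    (B : R[i] -> 'M[R[i]]_(n, p)) :
  (forall i j, analytic_on D (fun z => A z i j)) ->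
  (forall i j, analytic_on D (fun z => B z i j)) ->
  forall i j, analytic_on D (fun z => (A z *m B z) i j).
Proof.
move=> dA dB i j; under eq_fun do rewrite mxE.
apply: (@analytic_on_sum _ _ _ (fun k z => A z i k * B z k j)) => k.
exact: (analytic_on_mul (dA i k) (dB k j)).
Qed.

Lemma near_eq_dlnmu2 (f g : R -> R) mu : 0 < mu ->
  (\forall nu \near mu, f nu = g nu) -> dlnmu2 f mu = dlnmu2 g mu.
Proof.
move=> mu0 fg; rewrite /dlnmu2 !derive1E; apply: near_eq_derive.
have e : expR (ln (mu ^+ 2) / 2) = mu.
  by rewrite lnXn // -(mulr_natr (ln mu)) mulfK ?pnatr_eq0 // lnK.
have c : {for ln (mu ^+ 2), continuous (fun t : R => expR (t / 2))}.
  apply: continuous_comp; last exact: continuous_expR.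
  exact: mulrr_continuous.
have fg' : nbhs (expR (ln (mu ^+ 2) / 2)) [set nu | f nu = g nu] by rewrite e.
exact: (c _ fg').
Qed.

(** Entries on one orbit agree for all nu > mu0, hence near mu, and derivatives depend only on
    germs. The bound 0 <= mu0 makes mu positive, so that t = ln mu^2 does correspond to mu. *)
Lemma in_commutant_mdlnmu2 Nf (mu0 : R) (A : R -> 'M[R[i]]_(flavors Nf)) mu :
  0 <= mu0 -> mu0 < mu -> (forall nu, mu0 < nu -> in_commutant (A nu)) ->
  in_commutant (mdlnmu2 A mu).
Proof.
move=> mu0_ge0 mu0_mu cA; apply/in_commutantP => b s i j.
have mu_gt0 := le_lt_trans mu0_ge0 mu0_mu.
have near_mu : \forall nu \near mu, mu0 < nu by exact: lt_nbhsr.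
rewrite !mxE /cdlnmu2; congr (_ +i* _); apply: near_eq_dlnmu2 => //;
  by apply: filterS near_mu => nu /cA/in_commutantP ->.
Qed.
End ScaleDerivatives.

(** * Scheme transformations *)

Section SchemeTransformations.
Variables (R : realType) (Nf : nat).
Local Notation mat := 'M[R[i]]_(flavors Nf).
Implicit Types (D : set R[i]) (mu : R) (a : R -> R) (K : R[i] -> R -> mat).

Lemma power_series_sum a I (r : seq I) (F : I -> R -> R[i]) (c : I -> nat -> R[i]) :
  a @ +oo --> (0 : R) -> (forall i, power_series_in a (F i) (c i)) ->
  power_series_in a (fun mu => \sum_(i <- r) F i mu) (fun k => \sum_(i <- r) c i k).
Proof.
move=> a0 Fc; elim: r => [|i r IH].
  have -> : (fun mu => \sum_(i <- [::]) F i mu) = (fun=> 0).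
    by apply/funext => mu; rewrite big_nil.
  have -> : (fun k => \sum_(i <- [::]) c i k) = (fun k => if k is 0%N then 0 else 0).
    by apply/funext => -[|k]; rewrite big_nil.
  exact: power_series_cst.
have -> : (fun mu => \sum_(j <- i :: r) F j mu) =
    (fun mu => F i mu + \sum_(j <- r) F j mu).
  by apply/funext => mu; rewrite big_cons.
have -> : (fun k => \sum_(j <- i :: r) c j k) =
    (fun k => c i k + \sum_(j <- r) c j k).
  by apply/funext => k; rewrite big_cons.
exact: (power_seriesD (Fc i) IH).
Qed.

Lemma scheme_transformation_mul D mu0 a K1 K2 : a @ +oo --> (0 : R) ->
  scheme_transformation D mu0 a K1 -> scheme_transformation D mu0 a K2 ->
  scheme_transformation D mu0 a (fun z mu => K1 z mu *m K2 z mu).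
Proof.
move=> a0 [u1 an1 cj1 [c1 [c10 c1an c1s]]] [u2 an2 cj2 [c2 [c20 c2an c2s]]].
split.
- move=> z mu Dz h; have [uK1 dK1] := u1 z mu Dz h; have [uK2 dK2] := u2 z mu Dz h.
  by split; [rewrite unitmx_mul uK1 uK2 | exact: mdifferentiable_mul].
- move=> mu i j h; apply: (analytic_on_mulmx (A := K1^~ mu) (B := K2^~ mu)) => k l;
    [exact: an1 | exact: an2].
- by move=> z mu Dz h; rewrite cj1 // cj2 // (map_mxM (@conjc R)).
exists (fun k z => \sum_(i < k.+1) c1 i z *m c2 (k - i)%N z); split.
- by move=> z Dz; rewrite big_ord1 c10 // c20 // mulmx1.
- move=> k i j; under eq_fun do rewrite summxE.
  apply: (@analytic_on_sum _ _ _ _ (fun (l : 'I_k.+1) z => (c1 l z *m c2 (k - l)%N z) i j)) => l.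
  by apply: analytic_on_mulmx => *; [exact: c1an | exact: c2an].
move=> z i j Dz.
have -> : (fun mu => (K1 z mu *m K2 z mu) i j) =
    (fun mu => \sum_m K1 z mu i m * K2 z mu m j).
  by apply/funext => mu; rewrite mxE.
have -> : (fun k => (\sum_(l < k.+1) c1 l z *m c2 (k - l)%N z) i j) =
    (fun k => \sum_m \sum_(l < k.+1) c1 l z i m * c2 (k - l)%N z m j).
  apply/funext => k; rewrite summxE exchange_big /=.
  by apply: eq_bigr => l _; rewrite mxE.
apply: (@power_series_sum _ _ _ (fun m mu => K1 z mu i m * K2 z mu m j)) => // m.
exact: (power_seriesM a0 (c1s z i m Dz) (c2s z m j Dz)).
Qed.

Lemma scheme_transformation_ge D mu0 mu1 a K : mu0 <= mu1 ->
  scheme_transformation D mu0 a K -> scheme_transformation D mu1 a K.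
Proof.
move=> le01 [u an cj s]; split=> //.
- by move=> z mu Dz h; apply: u => //; exact: le_lt_trans h.
- by move=> mu i j h; apply: an; exact: le_lt_trans h.
- by move=> z mu Dz h; apply: cj => //; exact: le_lt_trans h.
Qed.

Lemma anomalous_dimension_ge D mu0 mu1 gamma : mu0 <= mu1 ->
  @anomalous_dimension R Nf D mu0 gamma -> anomalous_dimension D mu1 gamma.
Proof.
move=> le01 [cg gM gN]; split.
- by move=> z mu Dz h; apply: cg => //; exact: le_lt_trans h.
- by move=> mu h; apply: gM; exact: le_lt_trans h.
- by move=> mu i h; apply: gN; exact: le_lt_trans h.
Qed.

Lemma admissible_of_sum_rule_covectors D mu0 a n gamma K : 0 <= mu0 ->
  scheme_transformation D mu0 a K -> anomalous_dimension D mu0 gamma ->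
  (forall z mu, D z -> mu0 < mu -> in_commutant (K z mu)) ->
  sum_rule_covectors mu0 K -> admissible D mu0 a n gamma K.
Proof.
move=> mu0_ge0 sK [cg _ _] cK [KM KN]; have [uK _ _ _] := sK; split=> //.
- move=> z mu Dz h; have [u _] := uK z mu Dz h.
  have cV := in_commutant_inv u (cK z mu Dz h).
  apply: in_commutant_add; apply: in_commutant_mul => //.
    by apply: in_commutant_mul; [exact: cK | exact: cg].
  by apply: (in_commutant_mdlnmu2 mu0_ge0 h) => nu; exact: cK.
- move=> f _ [fM fN]; split.
    by move=> mu h; rewrite /transform_density mulmxA KM // fM.
  by move=> mu i h; rewrite /transform_density mulmxA KN // fN.
Qed.

Lemma normalized_sum_rule_covectors D mu0 a K etaS etaNS KN : (0 < Nf)%N ->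
  moment_domain D -> scheme_transformation D mu0 a K ->
  (forall z mu, D z -> mu0 < mu -> in_commutant (K z mu)) ->
  odd_scalars mu0 K etaS etaNS -> normalization_of mu0 K etaS etaNS KN ->
  sum_rule_covectors mu0 (fun z mu => KN mu *m K z mu).
Proof.
move=> Nf_gt0 [_ _ D1 D2] [uK _ _ _] cK oK nKN; split=> [mu|mu i] h.
  have [cN _ _ NP Ng] := nKN mu h; have [u _] := uK _ _ D2 h.
  by apply: qM_normalized => //; exact: cK.
have [cN NS Nns _ _] := nKN mu h; have [u _] := uK _ _ D1 h.
have [KS Kns] := oK mu h.
apply: qN_preserved => //.
- by apply: in_commutant_mul => //; exact: cK.
- exact: mul_inverse_scalar KS NS.
- by move=> v hv; rewrite scale1r; apply: mul_inverse_scalar (Kns v hv) (Nns v hv).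
Qed.

Lemma normalized_admissible D mu0 a n gamma K etaS etaNS KN : (0 < Nf)%N ->
  moment_domain D -> 0 <= mu0 -> a @ +oo --> (0 : R) ->
  anomalous_dimension D mu0 gamma -> scheme_transformation D mu0 a K ->
  (forall z mu, D z -> mu0 < mu -> in_commutant (K z mu)) ->
  odd_scalars mu0 K etaS etaNS -> normalization_of mu0 K etaS etaNS KN ->
  scheme_transformation D mu0 a (fun=> KN) ->
  admissible D mu0 a n gamma (fun z mu => KN mu *m K z mu).
Proof.
move=> Nf_gt0 hD mu0_ge0 a0 hg sK cK oK nKN sKN.
apply: admissible_of_sum_rule_covectors => //.
- exact: (scheme_transformation_mul a0 sKN sK).
- move=> z mu Dz h; have [cN _ _ _ _] := nKN mu h.
  by apply: in_commutant_mul => //; exact: cK.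
- exact: (normalized_sum_rule_covectors Nf_gt0 hD sK cK oK nKN).
Qed.
End SchemeTransformations.

(** * Real differentiable functions of the scale with an expansion in the coupling *)

Section PerturbativeScalars.
Variables (R : realType) (mu0 : R) (a : R -> R).
Hypothesis a_cvg0 : a @ +oo --> (0 : R).
Implicit Types (f g : R -> R[i]) (x y : R[i]).

Lemma conjc_fixedP x : reflect (x^*%C = x) (x \is Num.real).
Proof.
apply: (iffP idP) => [/complex_realP[k ->]|]; first exact: conjc_real.
case: x => u v; rewrite complex_real => -[] /eqP.
by rewrite eq_sym -subr_eq0 opprK -mulr2n mulrn_eq0.
Qed.

(* x is the limit of f, i.e. the constant term of its expansion in a. *)
Definition perturbative f x : Prop :=
  [/\ forall mu, mu0 < mu -> f mu \is Num.real,
      forall mu, mu0 < mu -> cdifferentiable f mu &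
      exists2 c, c 0%N = x & power_series_in a f c].

Lemma perturbative_cst x : x \is Num.real -> perturbative (fun=> x) x.
Proof.
move=> xr; split; [by [] | by move=> mu _; exact: cdifferentiable_cst|].
by exists (fun k => if k is 0%N then x else 0) => //; exact: power_series_cst.
Qed.

Lemma perturbativeD f g x y : perturbative f x -> perturbative g y ->
  perturbative (fun mu => f mu + g mu) (x + y).
Proof.
move=> [fr fd [c <- fc]] [gr gd [d <- gc]]; split.
- by move=> mu h; apply: realD; [exact: fr | exact: gr].
- by move=> mu h; apply: cdifferentiableD; [exact: fd | exact: gd].
- by exists (fun k => c k + d k) => //; exact: (power_seriesD fc gc).
Qed.

Lemma perturbativeM f g x y : perturbative f x -> perturbative g y ->
  perturbative (fun mu => f mu * g mu) (x * y).
Proof.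
move=> [fr fd [c <- fc]] [gr gd [d <- gc]]; split.
- by move=> mu h; apply: realM; [exact: fr | exact: gr].
- by move=> mu h; apply: cdifferentiableM; [exact: fd | exact: gd].
- exists (fun k => \sum_(i < k.+1) c i * d (k - i)%N); first by rewrite big_ord1.
  exact: (power_seriesM a_cvg0 fc gc).
Qed.

Lemma perturbativeB f g x y : perturbative f x -> perturbative g y ->
  perturbative (fun mu => f mu - g mu) (x - y).
Proof.
move=> pf pg; have r1 : (-1 : R[i]) \is Num.real by rewrite realN real1.
have := perturbativeD pf (perturbativeM (perturbative_cst r1) pg).
by under eq_fun do rewrite mulN1r; rewrite mulN1r.
Qed.

Lemma perturbative_sum I (r : seq I) (P : pred I) (F : I -> R -> R[i]) (x : I -> R[i]) :
  (forall i, perturbative (F i) (x i)) ->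
  perturbative (fun mu => \sum_(i <- r | P i) F i mu) (\sum_(i <- r | P i) x i).
Proof.
move=> pF; elim: r => [|i r IH].
  by under eq_fun do rewrite big_nil; rewrite big_nil; exact/perturbative_cst/real0.
under eq_fun do rewrite big_cons; rewrite big_cons.
by case: (P i); [exact: (perturbativeD (pF i) IH) | exact: IH].
Qed.

(** The constant term x governs f only near infinity, whereas differentiability of 1 / f is claimed
    at every mu > mu0; hence the second nonvanishing condition. *)
Lemma perturbativeV f x : x != 0 -> (forall mu, mu0 < mu -> f mu != 0) ->
  perturbative f x -> perturbative (fun mu => (f mu)^-1) x^-1.
Proof.
move=> x0 f0 [fr fd [c cx fc]]; split.
- by move=> mu h; rewrite realV; exact: fr.
- by move=> mu h; apply: cdifferentiableV; [exact: f0 | exact: fd].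
- by rewrite -cx; apply: (power_seriesV a_cvg0 fc); rewrite cx.
Qed.

Lemma perturbative_neq0 f x : perturbative f x -> x != 0 ->
  \forall mu \near +oo, f mu != 0.
Proof.
move=> [_ _ [c <- fc]] c0; have [m m0 fm] := power_series_neq0 a_cvg0 fc c0.
apply: filterS fm => mu h; rewrite -normr_gt0; apply: lt_le_trans h.
by rewrite ltcR.
Qed.
End PerturbativeScalars.

Lemma perturbative_ge (R : realType) (mu0 mu1 : R) a f x : mu0 <= mu1 ->
  perturbative mu0 a f x -> perturbative mu1 a f x.
Proof.
move=> le01 [fr fd fc]; split=> // mu h; [apply: fr | apply: fd];
  exact: le_lt_trans h.
Qed.

(** * Construction of the normalization at large scales *)

Section Normalization.
Variables (R : realType) (Nf : nat) (mu0 : R) (a : R -> R).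
Hypothesis a_cvg0 : a @ +oo --> (0 : R).
Local Notation mat := 'M[R[i]]_(flavors Nf).
Local Notation ig := (ig Nf).
Implicit Types (D : set R[i]) (A : R -> mat).

Definition perturbative_mx A : Prop :=
  forall i j, perturbative mu0 a (fun mu => A mu i j) (i == j)%:R.

Lemma scheme_transformation_perturbative D K z :
  scheme_transformation D mu0 a K -> D z -> z^*%C = z -> perturbative_mx (K z).
Proof.
move=> [uK _ cj [c [c0 _ cs]]] Dz zz i j; split.
- move=> mu h; apply/conjc_fixedP.
  by have /matrixP/(_ i j) := cj z mu Dz h; rewrite zz mxE => <-.
- by move=> mu h; have [_ dK] := uK z mu Dz h; exact: dK.
- by exists (fun k => c k z i j); [rewrite c0 // mxE | exact: cs].
Qed.

(** For a matrix independent of z the reflection condition says that the entries are real, which is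
    why [perturbative] includes reality. *)
Lemma perturbative_scheme_transformation D A :
  (forall mu, mu0 < mu -> A mu \in unitmx) -> perturbative_mx A ->
  scheme_transformation D mu0 a (fun=> A).
Proof.
move=> uA pA; split.
- by move=> z mu _ h; split; [exact: uA | move=> i j; have [_ d _] := pA i j; exact: d].
- by move=> mu i j _; exact: analytic_on_cst.
- move=> z mu _ h; apply/matrixP => i j; rewrite mxE.
  by have [r _ _] := pA i j; apply/esym/conjc_fixedP; exact: r.
have pc i j : {c : nat -> R[i] | c 0%N = (i == j)%:R /\
    power_series_in a (fun mu => A mu i j) c}.
  by apply: cid; have [_ _ [c c0 cs]] := pA i j; exists c.
exists (fun k z => \matrix_(i, j) sval (pc i j) k); split.
- by move=> z _; apply/matrixP => i j; rewrite !mxE; case: (svalP (pc i j)).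
- by move=> k i j; exact: analytic_on_cst.
- move=> z i j _; have [_ pcs] := svalP (pc i j).
  have -> : (fun k => (\matrix_(i, j) sval (pc i j) k : mat) i j) = sval (pc i j).
    by apply/funext => k; rewrite mxE.
  exact: pcs.
Qed.

Hypothesis Nf_gt0 : (0 < Nf)%N.
Let i0 : 'I_Nf := Ordinal Nf_gt0.

Lemma perturbative_odd_entry A (i j : 'I_Nf) : perturbative_mx A ->
  perturbative mu0 a (fun mu => odd_entry (A mu) i j) (i == j)%:R.
Proof.
move=> pA; have := perturbativeB a_cvg0 (pA (iq i) (iq j)) (pA (iq i) (iqbar j)).
by rewrite !eq_flavor subr0.
Qed.

Lemma perturbative_odd_singlet_scalar A : perturbative_mx A ->
  perturbative mu0 a (fun mu => odd_singlet_scalar Nf_gt0 (A mu)) 1.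
Proof.
move=> pA; have := perturbative_sum (index_enum _) predT
  (fun j => perturbative_odd_entry i0 j pA).
have := sumr_delta i0 (fun=> 1 : R[i]).
by under eq_bigr do rewrite mul1r; move=> ->.
Qed.

Lemma perturbative_odd_ns_scalar A : perturbative_mx A ->
  perturbative mu0 a (fun mu => odd_ns_scalar Nf_gt0 (A mu)) 1.
Proof.
move=> pA; have := perturbativeB a_cvg0 (perturbative_odd_entry i0 i0 pA)
  (perturbative_sum (index_enum _) (fun j => (j == rev_ord i0) && (j != i0))
     (fun j => perturbative_odd_entry i0 j pA)).
rewrite eqxx [X in _ - X]big1 ?subr0 // => j /andP[_ ji0].
by rewrite eq_sym (negbTE ji0).
Qed.

Lemma perturbative_quark_row A j : perturbative_mx A ->
  perturbative mu0 a (fun mu => quark_row (A mu) j) (j != ig)%:R.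
Proof.
move=> pA; have := perturbative_sum (index_enum _) predT
  (fun i => perturbativeD (pA (iq i) j) (pA (iqbar i) j)).
suff -> : \sum_i ((iq i == j)%:R + (iqbar i == j)%:R) = (j != ig)%:R :> R[i] by [].
rewrite big_split /=; case: (flavorP j) => [i|i|]; rewrite !eq_flavor /=.
- under eq_bigr do rewrite eq_iq eq_sym -[_%:R]mul1r.
  by rewrite sumr_delta big1 ?addr0 // => k _; rewrite eq_flavor.
- rewrite big1 => [|k _]; last by rewrite eq_flavor.
  under eq_bigr do rewrite eq_iqbar eq_sym -[_%:R]mul1r.
  by rewrite sumr_delta add0r.
- by rewrite !big1 ?addr0 // => k _; rewrite eq_flavor.
Qed.

Lemma perturbative_singlet_det A : perturbative_mx A ->
  perturbative mu0 a (fun mu => singlet_det Nf_gt0 (A mu)) 1.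
Proof.
move=> pA; have := perturbativeB a_cvg0
  (perturbativeM a_cvg0 (perturbative_quark_row (iq i0) pA) (pA ig ig))
  (perturbativeM a_cvg0 (perturbative_quark_row ig pA) (pA ig (iq i0))).
by rewrite !eq_flavor /= mulr1 mul0r subr0.
Qed.

(** Each entry is affine in x, y, s, t with real constants k1, ..., k4. These multiply x - 1, t - 1,
    s - t and y - 1, whose constant terms vanish, leaving the identity. *)
Lemma perturbative_sector_mx (x y s t : R -> R[i]) :
  perturbative mu0 a x 1 -> perturbative mu0 a y 1 ->
  perturbative mu0 a s 1 -> perturbative mu0 a t 1 ->
  perturbative_mx (fun mu => sector_mx Nf (x mu) (y mu) (s mu) (t mu)).
Proof.
move=> px py ps pt i j.
pose k1 := ((2 * Nf)%:R)^-1 * (SigmaP R Nf *m (SigmaP R Nf)^T) i j.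
pose k2 := 2%:R^-1 * (1%:M + (-1) *: C_mx R Nf) i j.
pose k3 := ((2 * Nf)%:R)^-1 * (SigmaM R Nf *m (SigmaM R Nf)^T) i j.
pose k4 := (vgluon R Nf *m (vgluon R Nf)^T) i j.
have eE mu : sector_mx Nf (x mu) (y mu) (s mu) (t mu) i j = (i == j)%:R
    + (x mu - 1) * k1 + (t mu - 1) * k2 + (s mu - t mu) * k3 + (y mu - 1) * k4.
  have ZE (c : R[i]) (M : mat) : (c *: M) i j = c * M i j by rewrite mxE.
  have DE (M N : mat) : (M + N) i j = M i j + N i j by rewrite mxE.
  rewrite /sector_mx !DE !ZE -/k4 /k1 /k2 /k3 DE ZE [1%:M i j]mxE.
  by rewrite !mulrA.
under eq_fun do rewrite eE.
have natr_real n : (n%:R : R[i]) \is Num.real by exact: realn.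
have real_SigmaP k : SigmaP R Nf k 0 \is Num.real.
  have [P1 P2 P3] := SigmaPE R Nf.
  by case: (flavorP k) => *; rewrite ?(P1, P2, P3) ?real0 ?real1.
have real_SigmaM k : SigmaM R Nf k 0 \is Num.real.
  have [P1 P2 P3] := SigmaME R Nf.
  by case: (flavorP k) => *; rewrite ?(P1, P2, P3) ?realN ?real0 ?real1.
have real_outer (u : 'cV[R[i]]_(flavors Nf)) : (forall k, u k 0 \is Num.real) ->
    (u *m u^T) i j \is Num.real.
  by move=> ur; rewrite mxE big_ord1 mxE realM.
have r1 : k1 \is Num.real by rewrite realM ?realV ?real_outer.
have r2 : k2 \is Num.real.
  rewrite realM ?realV // C_mxE /perm_mx !mxE.
  by rewrite realD ?realM ?realN ?real1.
have r3 : k3 \is Num.real by rewrite realM ?realV ?real_outer.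
have r4 : k4 \is Num.real.
  by apply: real_outer => k; rewrite /vgluon vec_eE.
have p1 := perturbative_cst mu0 a (real1 _).
have cst k : k \is Num.real -> perturbative mu0 a (fun=> k) k.
  exact: perturbative_cst.
have M := perturbativeM a_cvg0; have B := perturbativeB a_cvg0.
have := perturbativeD (perturbativeD (perturbativeD (perturbativeD
  (cst _ (natr_real (i == j)))
  (M _ _ _ _ _ (B _ _ _ _ _ px p1) (cst _ r1)))
  (M _ _ _ _ _ (B _ _ _ _ _ pt p1) (cst _ r2)))
  (M _ _ _ _ _ (B _ _ _ _ _ ps pt) (cst _ r3)))
  (M _ _ _ _ _ (B _ _ _ _ _ py p1) (cst _ r4)).
by rewrite !subrr !mul0r !addr0.
Qed.
End Normalization.

Unset Implicit Arguments.

Theorem mainTheorem5 (R : realType) (Nf : nat) (Nf_gt0 : (0 < Nf)%N)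
    (D : set R[i]) (hD : moment_domain D)
    (mu0 : R) (mu0_ge0 : 0 <= mu0)
    (a_s : R -> R) (ha : coupling mu0 a_s)
    (n : 'I_Nf -> int)
    (gamma : R[i] -> R -> 'M[R[i]]_(Nf + Nf + 1))
    (hgamma : anomalous_dimension D mu0 gamma)
    (K : R[i] -> R -> 'M[R[i]]_(Nf + Nf + 1))
    (hK : scheme_transformation D mu0 a_s K)
    (hKG : forall z mu, D z -> mu0 < mu -> in_commutant (K z mu)) :
  (* every normalization of a transformation failing the sum rules works *)
  (~ sum_rule_covectors mu0 K ->
   forall (etaS etaNS : R -> R[i]) (KN : R -> 'M[R[i]]_(Nf + Nf + 1)),
     odd_scalars mu0 K etaS etaNS ->
     normalization_of mu0 K etaS etaNS KN ->
     scheme_transformation D mu0 a_s (fun=> KN) ->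
     [/\ forall mu, mu0 < mu ->
           qM R Nf *m (KN mu *m K 2%:R mu) = qM R Nf,
         forall mu (i : 'I_Nf), mu0 < mu ->
           qN R i *m (KN mu *m K 1 mu) = qN R i,
         admissible D mu0 a_s n gamma (fun z mu => KN mu *m K z mu) &
         forall mu, mu0 < mu -> pointwise_reweighting (KN mu)])
  /\
  (* perturbatively (at large enough scales) such a normalization exists, fixed
     by etaS, etaNS, nSigma, ngluon alone (trivial on the C-even non-singlet) *)
  (exists (mu1 : R) (etaS etaNS : R -> R[i])
          (KN : R -> 'M[R[i]]_(Nf + Nf + 1)),
     mu0 <= mu1 /\
     [/\ odd_scalars mu1 K etaS etaNS,
         normalization_of mu1 K etaS etaNS KN,
         forall mu, mu1 < mu -> acts_as (KN mu) (@ns_even R Nf) 1,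
         scheme_transformation D mu1 a_s (fun=> KN) &
         admissible D mu1 a_s n gamma (fun z mu => KN mu *m K z mu) /\
         forall mu, mu1 < mu -> pointwise_reweighting (KN mu)]).
Proof.
have a0 : a_s @ +oo --> (0 : R) by case: ha => beta [_ _ _].
have [_ _ D1 D2] := hD; split.
  move=> _ etaS etaNS KN oK nKN sKN.
  have [cM cN] := normalized_sum_rule_covectors Nf_gt0 hD hK hKG oK nKN.
  split=> // [|mu _]; last exact: pointwise_reweighting_mx.
  exact: (normalized_admissible n Nf_gt0 hD mu0_ge0 a0 hgamma hK hKG oK nKN sKN).
have pK1 := scheme_transformation_perturbative hK D1 (conjc1 R).
have pK2 := scheme_transformation_perturbative hK D2 (conjc_nat R 2).
pose i0 : 'I_Nf := Ordinal Nf_gt0.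
pose etaS mu := odd_singlet_scalar Nf_gt0 (K 1 mu).
pose etaNS mu := odd_ns_scalar Nf_gt0 (K 1 mu).
pose det mu := singlet_det Nf_gt0 (K 2%:R mu).
(* Here x and y are the Cramer expressions for [nSigma] and [ngluon]. They are used instead of the
   inverse matrix because their expansions follow from those of the entries; the two agree once det
   is nonzero. *)
pose x mu := (K 2%:R mu (ig Nf) (ig Nf) - K 2%:R mu (ig Nf) (iq i0)) / det mu.
pose y mu :=
  (quark_row (K 2%:R mu) (iq i0) - quark_row (K 2%:R mu) (ig Nf)) / det mu.
pose KN mu := sector_mx Nf (x mu) (y mu) (etaS mu)^-1 (etaNS mu)^-1.
have pS : perturbative mu0 a_s etaS 1 by exact: perturbative_odd_singlet_scalar.
have pNS : perturbative mu0 a_s etaNS 1 by exact: perturbative_odd_ns_scalar.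
have pdet : perturbative mu0 a_s det 1 by exact: perturbative_singlet_det.
have pxn := perturbativeB a0 (pK2 (ig Nf) (ig Nf)) (pK2 (ig Nf) (iq i0)).
rewrite !eq_flavor subr0 in pxn.
have pyn := perturbativeB a0 (perturbative_quark_row (iq i0) pK2)
  (perturbative_quark_row (ig Nf) pK2).
rewrite !eq_flavor subr0 in pyn.
have one0 : (1 : R[i]) != 0 by exact: oner_neq0.
(* Nonvanishing of the etas, x and y makes K_N invertible; that of det validates the Cramer
   formulas. All five have constant term 1, so a threshold M exists, and mu1 is its maximum with
   mu0. *)
have [M [_ hM]] : \forall mu \near +oo, [/\ etaS mu != 0, etaNS mu != 0,
    det mu != 0, x mu != 0 & y mu != 0].
  have [nS nNS] := (perturbative_neq0 a0 pS one0, perturbative_neq0 a0 pNS one0).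
  have nd := perturbative_neq0 a0 pdet one0.
  have [nx ny] := (perturbative_neq0 a0 pxn one0, perturbative_neq0 a0 pyn one0).
  near=> mu; have d0 : det mu != 0 by near: mu.
  have S0 : etaS mu != 0 by near: mu.
  have NS0 : etaNS mu != 0 by near: mu.
  split=> //; apply: mulf_neq0; rewrite ?invr_eq0 //; by near: mu.
pose mu1 := Num.max mu0 M.
have le01 : mu0 <= mu1 by rewrite le_max lexx.
have hM1 mu : mu1 < mu ->
    [/\ etaS mu != 0, etaNS mu != 0, det mu != 0, x mu != 0 & y mu != 0].
  by rewrite gt_max => /andP[_]; exact: hM.
have sK1 := scheme_transformation_ge le01 hK.
have hKG1 z mu : D z -> mu1 < mu -> in_commutant (K z mu).
  by move=> Dz h; apply: hKG => //; exact: le_lt_trans h.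
have oK : odd_scalars mu1 K etaS etaNS.
  move=> mu h; split; first exact/odd_singlet_scalarP/hKG1.
  exact/odd_ns_scalarP/hKG1.
have nKN : normalization_of mu1 K etaS etaNS KN.
  move=> mu h; have [S0 NS0 d0 x0 y0] := hM1 mu h.
  have [NP NM Ne No Ng] :=
    sector_mx_acts Nf_gt0 (x mu) (y mu) (etaS mu)^-1 (etaNS mu)^-1.
  have [uK _ _ _] := sK1; have [uK2 _] := uK _ _ D2 h.
  have e := restr_singlet_inv (hKG1 _ _ D2 h) uK2 d0.
  have ex : nSigma K mu = x mu by rewrite /nSigma e.
  have ey : ngluon K mu = y mu by rewrite /ngluon e.
  by rewrite ex ey; split=> //; exact: in_commutant_sector_mx.
have pmx : perturbative_mx mu1 a_s KN.
  have ge f c := @perturbative_ge R mu0 mu1 a_s f c le01.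
  have pd : perturbative mu1 a_s (fun mu => (det mu)^-1) 1.
    by rewrite -invr1; apply: perturbativeV (ge _ _ pdet) => // mu /hM1[].
  apply: perturbative_sector_mx => //.
  - by have := perturbativeM a0 (ge _ _ pxn) pd; rewrite mulr1.
  - by have := perturbativeM a0 (ge _ _ pyn) pd; rewrite mulr1.
  - by rewrite -invr1; apply: perturbativeV (ge _ _ pS) => // mu /hM1[].
  - by rewrite -invr1; apply: perturbativeV (ge _ _ pNS) => // mu /hM1[].
have sKN : scheme_transformation D mu1 a_s (fun=> KN).
  apply: perturbative_scheme_transformation => // mu /hM1[S0 NS0 d0 x0 y0].
  by apply: sector_mx_unit; rewrite ?invr_eq0.
exists mu1, etaS, etaNS, KN; split=> //; split=> //.
  by move=> mu _; have [] := sector_mx_acts Nf_gt0 (x mu) (y mu) (etaS mu)^-1 (etaNS mu)^-1.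
split=> [|mu _]; last exact: pointwise_reweighting_mx.
apply: (normalized_admissible n Nf_gt0 hD (le_trans mu0_ge0 le01) a0 _ sK1 hKG1 oK nKN sKN).
exact: anomalous_dimension_ge hgamma.
Unshelve. all: by end_near.
Qed.
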